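(* Up to combinatorial isomorphism, there are exactly $56$ equivelar polyhedral maps on the non-orientable surface of genus $4$: $28$ of type $(3,7;12)$ and $28$ of type $(7,3;28)$.
   Context: A map on a closed surface $M$ is a decomposition of $M$ into a finite cell complex (vertices, edges, and polygonal $2$-cells). A map is polyhedral if the intersection of any two of its polygons is either empty, a common vertex, or a common edge. A map is equivelar of type $\{p,q\}$ if every $2$-cell is a $p$-gon and every vertex has degree $q$, where $p,q\geq 3$; it has type $(p,q;n)$ if moreover it has exactly $n$ vertices. An equivelar polyhedral map is a map that is both equivelar and polyhedral. Two maps are combinatorially isomorphic if there is an isomorphism of their cell complexes (an incidence-preserving bijection of vertices, edges, and polygons). The non-orientable surface of genus $4$ is the closed connected non-orientable surface with Euler characteristic $-2$ (the connected sum of $4$ projective planes). *)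

(* Defs.v *)
From mathcomp Require Import all_boot all_order all_algebra.

Set Implicit Arguments.
Unset Strict Implicit.
Unset Printing Implicit Defensive.

Local Open Scope nat_scope.

(** A map on a closed surface is represented by the incidence structure of its
    cell complex.  A polygon is a closed 2-cell whose boundary is a circuit of
    distinct vertices and distinct edges, so the complex is a regular one: it is
    determined by the incidences of its cells, and an edge or a polygon is
    incident with a cell of lower dimension when it contains it.  Edges are
    cells of their own and not pairs of vertices; parallel edges are possible. *)
Record cell_complex : Type := CellComplex {
  vertex : finType;
  edge : finType;
  polygon : finType;
  inc_ve : vertex -> edge -> bool;
  inc_ep : edge -> polygon -> bool
}.

Definition edge_ends (M : cell_complex) (e : edge M) : {set vertex M} :=
  [set v | inc_ve v e].

Definition edges_at (M : cell_complex) (v : vertex M) : {set edge M} :=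
  [set e | inc_ve v e].

Definition polygons_at (M : cell_complex) (e : edge M) : {set polygon M} :=
  [set f | inc_ep e f].

Definition polygon_edges (M : cell_complex) (f : polygon M) : {set edge M} :=
  [set e | inc_ep e f].

Definition polygon_vertices (M : cell_complex) (f : polygon M) :
    {set vertex M} :=
  \bigcup_(e in polygon_edges f) edge_ends e.

(** [A] is nonempty and any two elements of [A] are joined by an [r]-path that
    stays inside [A]. *)
Definition connected_on (T : finType) (A : {set T}) (r : rel T) : Prop :=
  A != set0 /\
  {in A &, forall x y, connect [rel a b | [&& a \in A, b \in A & r a b]] x y}.

(** The underlying space is a connected closed surface.  [polygon_degree] and
    [polygon_connected] say that the boundary of a polygon is a single circuit.
    The link of a vertex [v] is the graph whose nodes are the edges at [v] and
    whose arcs are the corners at [v] of the polygons; it is 2-regular by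
    [edge_sides] and [polygon_degree], and [link_connected] makes it a single
    circuit, so that [v] has a neighbourhood homeomorphic to a disc. *)
Record is_surface_map (M : cell_complex) : Prop := IsSurfaceMap {
  edge_two_ends : forall e : edge M, #|edge_ends e| = 2;
  edge_sides : forall e : edge M, #|polygons_at e| = 2;
  polygon_degree : forall (f : polygon M) (v : vertex M),
    v \in polygon_vertices f -> #|edges_at v :&: polygon_edges f| = 2;
  polygon_connected : forall f : polygon M,
    connected_on (polygon_edges f)
      [rel e e' | [exists v, inc_ve v e && inc_ve v e']];
  link_connected : forall v : vertex M,
    connected_on (edges_at v)
      [rel e e' | [exists f, inc_ep e f && inc_ep e' f]];
  skeleton_connected :
    connected_on [set: vertex M]
      [rel u v | [exists e, inc_ve u e && inc_ve v e]]
}.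

Definition euler_char (M : cell_complex) : int :=
  (#|vertex M|%:Z - #|edge M|%:Z + #|polygon M|%:Z)%R.

(** [head f e] is the end point at which the edge [e] terminates when the
    boundary of [f] is traversed.  Choosing one end of every edge of a circuit
    injectively is the same as choosing one of its two senses of traversal.
    The surface is orientable when the polygons can be oriented in such a way
    that two polygons sharing an edge traverse it in opposite directions. *)
Definition orientable (M : cell_complex) : Prop :=
  exists head : polygon M -> edge M -> vertex M,
    [/\ forall f e, inc_ep e f -> inc_ve (head f e) e,
        forall f, {in polygon_edges f &, injective (head f)}
      & forall e f g, f != g -> inc_ep e f -> inc_ep e g ->
          head f e != head g e].

(** By the classification of closed surfaces, orientability and Euler
    characteristic determine the surface; the connected sum of [g] projective
    planes is the non-orientable one of characteristic [2 - g]. *)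
Definition on_nonorientable_surface (g : nat) (M : cell_complex) : Prop :=
  [/\ is_surface_map M, ~ orientable M & euler_char M = (2 - g%:Z)%R].

Definition equivelar_type (p q : nat) (M : cell_complex) : Prop :=
  [/\ 3 <= p, 3 <= q,
      forall f : polygon M, #|polygon_edges f| = p
    & forall v : vertex M, #|edges_at v| = q].

Definition equivelar (M : cell_complex) : Prop :=
  exists p q : nat, equivelar_type p q M.

Definition equivelar_type_n (p q n : nat) (M : cell_complex) : Prop :=
  equivelar_type p q M /\ #|vertex M| = n.

(** The intersection of two distinct polygons, as point sets, is the union of
    their common vertices and common edges. *)
Definition polyhedral (M : cell_complex) : Prop :=
  forall f g : polygon M, f != g ->
    let common_vertices := polygon_vertices f :&: polygon_vertices g in
    let common_edges := polygon_edges f :&: polygon_edges g in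
    [\/ common_vertices = set0 /\ common_edges = set0,
        exists v, common_vertices = [set v] /\ common_edges = set0
      | exists e, common_vertices = edge_ends e /\ common_edges = [set e]].

(** Incidence of vertices with polygons is preserved as well, since a vertex
    lies on a polygon exactly when it lies on one of its edges. *)
Definition isomorphic (M N : cell_complex) : Prop :=
  exists (phi0 : vertex M -> vertex N) (phi1 : edge M -> edge N)
         (phi2 : polygon M -> polygon N),
    [/\ bijective phi0, bijective phi1, bijective phi2,
        forall v e, inc_ve (phi0 v) (phi1 e) = inc_ve v e
      & forall e f, inc_ep (phi1 e) (phi2 f) = inc_ep e f].

Definition exactly_up_to_iso (n : nat) (P : cell_complex -> Prop) : Prop :=
  exists s : 'I_n -> cell_complex,
    [/\ forall i, P (s i),
        forall i j, isomorphic (s i) (s j) -> i = j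
      & forall M, P M -> exists i, isomorphic M (s i)].

(* Main.v *)
Require Import Defs.
From mathcomp Require Import all_boot all_order all_algebra.
From mathcomp Require Import zify.

Set Implicit Arguments.
Unset Strict Implicit.
Unset Printing Implicit Defensive.

(** Why there are 28 + 28 maps.

    Euler's formula and the polyhedral condition leave two types.  In an
    equivelar map of type {p, q} with n vertices and characteristic -2, counting
    edges from their ends and from their sides gives n (pq - 2p - 2q) = 4p; in a
    polyhedral map the polygons around a vertex meet pairwise in at most one more
    vertex, so that its star has q (p - 2) + 1 distinct vertices.  Both hold only
    for (3, 7; 12) and (7, 3; 28) ([equivelar_polyhedral_types]).  Passing to the
    dual map exchanges these two types and preserves the surface, polyhedrality
    and isomorphism ([dual_surface], [dual_orientable], [dual_polyhedral]), so it
    suffices to count the maps by triangles.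

    A polyhedral map by triangles is determined by the ternary relation that
    holds of the vertex triples of its polygons: it is isomorphic to the map
    [complex_of] built from that relation, and it is orientable exactly when the
    relation has an [orientation].  The maps of type (3, 7; 12) thus become
    [triangulation]s of degree 7 on 12 vertices, where the link of every vertex
    is a circuit of length 7.

    These are enumerated by a search which is run by the kernel.  It starts from
    one triangle, takes an edge on which only one triangle is known, and tries
    every vertex, known or new, as the third vertex of the other triangle; new
    vertices are numbered in the order of their discovery, so nothing is lost by
    calling the next one by the next number.  The search abandons a partial
    triangulation when some known link cannot be completed to a circuit of
    length 7, and it is cut further by symmetry: [explored_first_triangle] shows
    that one of two small patterns occurs in every triangulation, after which it
    is enough to explore from these patterns, and from the second one only as
    long as the first one has not appeared.  Every complete triangulation that
    is reached contains one of 34 listed patterns of 28 triangles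
    ([triangulation_realizes_pattern]), and a map that contains a pattern of 28
    triangles is isomorphic to it ([realizes_complete]).

    Six of the patterns have an orientation, which is exhibited; in each of the
    other 28 the orientation of one triangle forces two contradictory
    orientations elsewhere ([conflicting_nonorientable]).  These 28 are pairwise
    non-isomorphic: an isomorphism is determined by the images of the vertices of
    one triangle, and following the pattern from every possible image fails
    ([embeds_complete]). *)

(** * Counting and connectedness *)

Lemma double_count (S T : finType) (A : {set S}) (B : {set T}) (r : S -> T -> bool) :
  \sum_(x in A) #|[set y in B | r x y]| = \sum_(y in B) #|[set x in A | r x y]|.
Proof.
under eq_bigr => x _.
  rewrite -sum1_card (eq_bigl (fun y => (y \in B) && r x y)); last first.
    by move=> y; rewrite inE.
  rewrite big_mkcondr; over.
rewrite exchange_big /=; apply: eq_bigr => y _.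
rewrite -big_mkcondr -sum1_card; apply: eq_bigl => x.
by rewrite inE.
Qed.

Lemma card2_eq (T : finType) (A : {set T}) (x y : T) :
  #|A| = 2 -> x \in A -> y \in A -> x != y -> A = [set x; y].
Proof.
move=> cA xA yA xy; apply/esym/eqP; rewrite eqEcard cA cards2 xy andbT.
by apply/subsetP => z; rewrite !inE => /orP[] /eqP ->.
Qed.

Lemma inj_surj_bij (S T : finType) (f : S -> T) :
  injective f -> (forall y, exists x, f x = y) -> bijective f.
Proof.
move=> injf surjf; apply: inj_card_bij => //.
rewrite -(card_codom injf); apply: subset_leq_card.
by apply/subsetP => y _; have [x <-] := surjf y; apply: codom_f.
Qed.

(** Connectedness is used and proved below through closed sets: a set that is
    closed under the relation and meets [A] contains [A]. *)
Lemma connected_on_closed (T : finType) (A : {set T}) (r : rel T) (S : {set T}) :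
  connected_on A r -> (exists2 x, x \in A & x \in S) ->
  (forall x y, x \in A -> y \in A -> x \in S -> r x y -> y \in S) ->
  A \subset S.
Proof.
move=> [_ cA] [x xA xS] clS; apply/subsetP => y yA.
have /connectP[p pth ->] := cA x y xA yA.
elim: p x xA xS pth => [|z p IHp] x xA xS //= /andP[/and3P[_ zA xz]].
by apply: IHp => //; apply: clS xz.
Qed.

Lemma closed_connected_on (T : finType) (A : {set T}) (r : rel T) :
  A != set0 ->
  (forall S : {set T}, (exists2 x, x \in A & x \in S) ->
     (forall x y, x \in A -> y \in A -> x \in S -> r x y -> y \in S) ->
     A \subset S) ->
  connected_on A r.
Proof.
move=> A0 clA; split=> // x y xA yA.
set r' := [rel a b | _]; have /subsetP/(_ y yA) : A \subset [set z | connect r' x z].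
  apply: clA => [|a b aA bA]; first by exists x; rewrite ?inE.
  rewrite !inE => xa ab; apply: connect_trans xa (connect1 _) => /=.
  by rewrite aA bA.
by rewrite inE.
Qed.

(** * Duality *)

(** The edges stay in place, and the two incidences exchange their roles. *)
Definition dual (M : cell_complex) : cell_complex :=
  CellComplex (fun f e => @inc_ep M e f) (fun e v => @inc_ve M v e).

Definition polygons_around (M : cell_complex) (v : vertex M) : {set polygon M} :=
  [set f | v \in polygon_vertices f].

Lemma polygon_verticesP (M : cell_complex) (f : polygon M) (v : vertex M) :
  reflect (exists2 e, inc_ve v e & inc_ep e f) (v \in polygon_vertices f).
Proof.
apply: (iffP bigcupP) => [[e]|[e ve ef]].
  by rewrite !inE => ef ve; exists e.
by exists e; rewrite inE.
Qed.

Lemma dualK (M : cell_complex) : dual (dual M) = M.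
Proof. by case: M. Qed.

Lemma dual_polygon_vertices (M : cell_complex) (v : vertex M) :
  @polygon_vertices (dual M) v = polygons_around v.
Proof.
by apply/setP => f; rewrite inE; apply/polygon_verticesP/polygon_verticesP => -[e];
  exists e.
Qed.

Section SurfaceMaps.

Variable M : cell_complex.
Hypothesis surfM : is_surface_map M.

Implicit Types (u v w : vertex M) (e : edge M) (f g h : polygon M).

Lemma edge_at v : exists e, inc_ve v e.
Proof.
have [/set0Pn[e ve] _] := link_connected surfM v.
by exists e; rewrite inE in ve.
Qed.

Lemma polygon_edge f : exists e, inc_ep e f.
Proof.
have [/set0Pn[e ef] _] := polygon_connected surfM f.
by exists e; rewrite inE in ef.
Qed.

Lemma edge_end e : exists v, inc_ve v e.
Proof.
have /set0Pn[v ve] : edge_ends e != set0 by rewrite -card_gt0 edge_two_ends.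
by exists v; rewrite inE in ve.
Qed.

Lemma edge_side e : exists f, inc_ep e f.
Proof.
have /set0Pn[f ef] : polygons_at e != set0 by rewrite -card_gt0 edge_sides.
by exists f; rewrite inE in ef.
Qed.

(** Crossing an edge stays around both of its ends, so by the connectedness of
    the links a set of polygons closed under crossing edges contains all or
    none of the polygons around a vertex; the 1-skeleton carries this from one
    vertex to every other. *)
Lemma dual_skeleton_connected :
  connected_on [set: polygon M]
    [rel f g | [exists e, inc_ep e f && inc_ep e g]].
Proof.
apply: closed_connected_on.
  have [/set0Pn[v _] _] := skeleton_connected surfM.
  have [e _] := edge_at v; have [f _] := edge_side e.
  by apply/set0Pn; exists f.
move=> S [f0 _ f0S] clS.
have crossS f g e : f \in S -> inc_ep e f -> inc_ep e g -> g \in S.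
  by move=> fS ef eg; apply: (clS f) => //=; apply/existsP; exists e; rewrite ef.
pose touches e := [exists f in S, inc_ep e f].
have starS v e e' : inc_ve v e -> inc_ve v e' -> touches e -> touches e'.
  move=> ve ve' Se.
  have /subsetP/(_ e') : edges_at v \subset [set x | touches x].
    apply: (connected_on_closed (link_connected surfM v)).
      by exists e; rewrite inE.
    move=> a b _ _; rewrite !inE => /exists_inP[f fS af] /existsP[g /andP[ag bg]].
    by apply/exists_inP; exists g => //; apply: crossS fS af ag.
  by rewrite !inE; apply.
have /subsetP allv : [set: vertex M] \subset
    [set v | [exists e, inc_ve v e && touches e]].
  apply: (connected_on_closed (skeleton_connected surfM)).
    have [e ef0] := polygon_edge f0; have [v ve] := edge_end e; exists v => //.
    rewrite inE; apply/existsP; exists e; rewrite ve.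
    by apply/exists_inP; exists f0.
  move=> u v _ _; rewrite !inE => /existsP[e /andP[ue Se]] /=.
  move=> /existsP[e' /andP[ue' ve']]; apply/existsP; exists e'.
  by rewrite ve' (starS u e).
apply/subsetP => f _; have [e ef] := polygon_edge f; have [v ve] := edge_end e.
have := allv v; rewrite !inE => /(_ isT)/existsP[e' /andP[ve' Se']].
have /exists_inP[g gS eg] := starS _ _ _ ve' ve Se'.
exact: crossS eg ef.
Qed.

Lemma dual_surface : is_surface_map (dual M).
Proof.
split.
- exact: edge_sides surfM.
- exact: edge_two_ends surfM.
- move=> v f; rewrite dual_polygon_vertices inE => vf.
  by rewrite setIC; apply: (polygon_degree surfM vf).
- exact: link_connected surfM.
- exact: polygon_connected surfM.
- exact: dual_skeleton_connected.
Qed.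

(** Count the incident pairs of an edge and a vertex of [f]: either of them is in
    two such pairs. *)
Lemma card_polygon_vertices f : #|polygon_vertices f| = #|polygon_edges f|.
Proof.
have := double_count (polygon_vertices f) (polygon_edges f) (@inc_ve M).
rewrite (eq_bigr (fun=> 2)); last first.
  move=> v vf; rewrite -(polygon_degree surfM vf); apply: eq_card => e.
  by rewrite !inE andbC.
rewrite sum_nat_const [RHS](eq_bigr (fun=> 2)); last first.
  move=> e ef; rewrite -(edge_two_ends surfM e); apply: eq_card => v.
  rewrite !inE andbC; case: (boolP (inc_ve v e)) => //= ve.
  by apply/polygon_verticesP; exists e => //; rewrite inE in ef.
by rewrite sum_nat_const => /eqP; rewrite eqn_pmul2r // => /eqP.
Qed.

Lemma sum_vertex_degrees : \sum_(v : vertex M) #|edges_at v| = (#|edge M|).*2.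
Proof.
have := double_count [set: vertex M] [set: edge M] (@inc_ve M).
rewrite [RHS](eq_bigr (fun=> 2)); last first.
  by move=> e _; rewrite -(edge_two_ends surfM e); apply: eq_card => v; rewrite !inE.
rewrite sum_nat_const cardsT muln2 => <-; apply: eq_big => v; first by rewrite inE.
by move=> _; apply: eq_card => e; rewrite !inE.
Qed.

Lemma other_end v e : inc_ve v e -> exists2 u, u != v & edge_ends e = [set v; u].
Proof.
move=> ve; have vE : v \in edge_ends e by rewrite inE.
have := cardsD1 v (edge_ends e); rewrite edge_two_ends // vE => -[] /esym/eqP.
case/cards1P => u Eu; exists u.
  by have := set11 u; rewrite -Eu !inE => /andP[].
by rewrite -(setD1K vE) Eu.
Qed.

(** Two edges of a polygon with the same ends would form a closed circuit by
    themselves, and the boundary of a polygon is a single circuit. *)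
Lemma edge_ends_inj_in_polygon f e e' :
  2 < #|polygon_edges f| -> inc_ep e f -> inc_ep e' f ->
  edge_ends e = edge_ends e' -> e = e'.
Proof.
move=> f3 ef e'f ee'; apply/eqP/contraT => ne.
suff /subset_leq_card : polygon_edges f \subset [set e; e'].
  by rewrite cards2 ne leqNgt f3.
apply: (connected_on_closed (polygon_connected surfM f)).
  by exists e; rewrite !inE ?eqxx.
move=> a b _ bf aS /= /existsP[v /andP[va vb]].
have Ev : inc_ve v e = inc_ve v e' by move/setP/(_ v): ee'; rewrite !inE.
have ve : inc_ve v e by move: aS va; rewrite !inE => /orP[] /eqP->; rewrite ?Ev.
have ve' : inc_ve v e' by rewrite -Ev.
have vf : v \in polygon_vertices f by apply/polygon_verticesP; exists e.
rewrite -(card2_eq (polygon_degree surfM vf) _ _ ne) ?inE ?ve ?ve' ?ef ?e'f //.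
by rewrite vb /=; rewrite inE in bf.
Qed.

Hypothesis polyM : polyhedral M.
Hypothesis polygon3 : forall f, 2 < #|polygon_edges f|.

Lemma common_pair f g u v :
  f != g -> u != v ->
  u \in polygon_vertices f -> v \in polygon_vertices f ->
  u \in polygon_vertices g -> v \in polygon_vertices g ->
  exists e, [/\ edge_ends e = [set u; v], inc_ep e f & inc_ep e g].
Proof.
move=> fg uv uf vf ug vg; have := polyM fg => /=.
have uI : u \in polygon_vertices f :&: polygon_vertices g by rewrite inE uf.
have vI : v \in polygon_vertices f :&: polygon_vertices g by rewrite inE vf.
case=> [[E0 _]|[x [Ex _]]|[e [Ee ee]]].
- by move: uI; rewrite E0 inE.
- by move: uI vI uv; rewrite Ex !inE => /eqP-> /eqP->; rewrite eqxx.
- exists e; have : e \in [set e] by rewrite inE.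
  rewrite -ee !inE => /andP[-> ->]; split=> //.
  by apply: card2_eq (edge_two_ends surfM e) _ _ uv; rewrite -Ee.
Qed.

(** Were [e] and [e'] in different polygons, their common ends would make the
    polygons share one edge with these ends, which would be [e] in the one
    polygon and [e'] in the other. *)
Lemma edge_ends_inj : injective (@edge_ends M).
Proof.
move=> e e' ee'; have [f ef] := edge_side e; have [g e'g] := edge_side e'.
case: (eqVneq f g) => [fg|fg].
  by apply: (edge_ends_inj_in_polygon (polygon3 f)) => //; rewrite fg.
have [v ve] := edge_end e; have [u uv Ee] := other_end ve.
have sub x (xe : x \in edge_ends e) : x \in polygon_vertices f /\ x \in polygon_vertices g.
  split; apply/polygon_verticesP; first by exists e => //; rewrite inE in xe.
  by exists e' => //; move: xe; rewrite ee' inE.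
have [vf vg] : v \in polygon_vertices f /\ v \in polygon_vertices g.
  by apply: sub; rewrite inE.
have [uf ug] : u \in polygon_vertices f /\ u \in polygon_vertices g.
  by apply: sub; rewrite Ee !inE eqxx orbT.
have vu : v != u by rewrite eq_sym.
have [d [Ed df dg]] := common_pair fg vu vf uf vg ug.
rewrite (edge_ends_inj_in_polygon (polygon3 f) ef df) ?Ed //.
by apply: (edge_ends_inj_in_polygon (polygon3 g)) => //; rewrite Ed -Ee.
Qed.

(** A side [g] of [e] other than [f] shares both ends of [e] with [f], hence an
    edge with these ends, and this edge is [e]. *)
Lemma edge_in_polygon e f :
  edge_ends e \subset polygon_vertices f -> inc_ep e f.
Proof.
move=> /subsetP sub; apply/contraT => nef.
have [g eg] := edge_side e.
have fg : f != g by apply: contraNneq nef => ->.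
have [v ve] := edge_end e; have [u uv Ee] := other_end ve.
have vu : v != u by rewrite eq_sym.
have inEe x : x \in edge_ends e -> x \in polygon_vertices g.
  by rewrite inE => xe; apply/polygon_verticesP; exists e.
have vE : v \in edge_ends e by rewrite inE.
have uE : u \in edge_ends e by rewrite Ee !inE eqxx orbT.
have [d [Ed df _]] := common_pair fg vu (sub _ vE) (sub _ uE) (inEe _ vE) (inEe _ uE).
by rewrite -Ee in Ed; rewrite -(edge_ends_inj Ed) df in nef.
Qed.

(** For adjacent vertices the polyhedral condition of the dual map holds with the
    edge that joins them. *)
Lemma common_polygons u v e : u != v -> inc_ve u e -> inc_ve v e ->
  polygons_around u :&: polygons_around v = polygons_at e
  /\ edges_at u :&: edges_at v = [set e].
Proof.
move=> uv ue ve.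
have Ee : edge_ends e = [set u; v].
  by apply: card2_eq (edge_two_ends surfM e) _ _ uv; rewrite inE.
split; apply/setP => x; rewrite !inE.
  apply/andP/idP => [[ux vx]|ex]; last by split; apply/polygon_verticesP; exists e.
  by apply: edge_in_polygon; rewrite Ee subUset !sub1set ux.
apply/andP/eqP => [[ux vx]|-> //]; apply: edge_ends_inj; rewrite Ee.
by apply: card2_eq (edge_two_ends surfM x) _ _ uv; rewrite inE.
Qed.

Lemma dual_polyhedral : polyhedral (dual M).
Proof.
move=> u v uv /=; rewrite !dual_polygon_vertices.
rewrite -[@polygon_edges (dual M) u]/(edges_at u) -[@polygon_edges (dual M) v]/(edges_at v).
have [E0|/set0Pn[e]] := eqVneq (edges_at u :&: edges_at v) set0; last first.
  by rewrite !inE => /andP[ue ve]; apply: Or33; exists e; apply: common_polygons.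
have [F0|/set0Pn[f]] := eqVneq (polygons_around u :&: polygons_around v) set0.
  exact: Or31.
rewrite !inE => /andP[uf vf]; apply: Or32; exists f; split=> //.
apply/setP => g; rewrite !inE; apply/andP/eqP => [[ug vg]|-> //].
apply/eqP/contraT => gf; have [e [Ee _ _]] := common_pair gf uv ug vg uf vf.
have : e \in edges_at u :&: edges_at v.
  have /setP Eu := Ee; have := (Eu u, Eu v).
  by rewrite !inE !eqxx orbT => -[-> ->].
by rewrite E0 inE.
Qed.

End SurfaceMaps.

(** * Equivelar polyhedral maps of characteristic -2 *)

Section Star.

Variable M : cell_complex.
Hypotheses (surfM : is_surface_map M) (polyM : polyhedral M).
Hypothesis polygon3 : forall f : polygon M, 2 < #|polygon_edges f|.

Lemma common_polygons_bound (v w : vertex M) : v != w ->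
  #|polygons_around v :&: polygons_around w| <= 1 + #|edges_at v :&: edges_at w|.
Proof.
move=> vw; have := dual_polyhedral surfM polyM polygon3 vw => /=.
rewrite !dual_polygon_vertices.
case=> [[-> _]|[f [-> _]]|[e [-> E1]]]; rewrite ?cards0 ?cards1 ?leq_addr //.
have {}E1 : edges_at v :&: edges_at w = [set e] by exact: E1.
by rewrite E1 cards1 (edge_sides surfM e).
Qed.

(** Counting the pairs of a polygon around [v] and another vertex of it, a
    vertex is counted at most once, or at most twice if it is adjacent to [v]. *)
Lemma star_bound (v : vertex M) :
  \sum_(f in polygons_around v) #|polygon_edges f|.-1
    <= #|vertex M|.-1 + #|edges_at v|.
Proof.
have -> : \sum_(f in polygons_around v) #|polygon_edges f|.-1 =
    \sum_(w in [set~ v]) #|polygons_around v :&: polygons_around w|.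
  have := double_count (polygons_around v) [set~ v]
    (fun f w => w \in polygon_vertices f).
  rewrite (eq_bigr (fun f => #|polygon_edges f|.-1)) => [->|f vf].
    by apply: eq_bigr => w _; apply: eq_card => f; rewrite !inE.
  rewrite -(card_polygon_vertices surfM) (cardsD1 v (polygon_vertices f)).
  rewrite inE in vf; rewrite vf /=; apply: eq_card => w; by rewrite !inE.
apply: (@leq_trans (\sum_(w in [set~ v]) (1 + #|edges_at v :&: edges_at w|))).
  by apply: leq_sum => w; rewrite !inE eq_sym; apply: common_polygons_bound.
rewrite big_split /= sum1_card cardsC1 leq_add2l.
have := double_count (edges_at v) [set~ v] (fun e w => @inc_ve M w e).
rewrite (eq_bigr (fun=> 1)) => [|e ve].
  rewrite sum1_card => ->; apply/eq_leq; apply: eq_bigr => w _.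
  by apply: eq_card => e; rewrite !inE.
rewrite inE in ve; have := edge_two_ends surfM e.
rewrite (cardsD1 v) inE ve => -[] <-; apply: eq_card => w.
by rewrite !inE.
Qed.

Lemma card_polygons_around (v : vertex M) : #|polygons_around v| = #|edges_at v|.
Proof.
have := card_polygon_vertices (dual_surface surfM) v.
by rewrite dual_polygon_vertices.
Qed.

End Star.

Lemma equivelar_counts (p q : nat) (M : cell_complex) :
  is_surface_map M -> equivelar_type p q M ->
  #|vertex M| * q = (#|edge M|).*2 /\ #|polygon M| * p = (#|edge M|).*2.
Proof.
move=> surfM [_ _ Hp Hq]; split.
  rewrite -(sum_vertex_degrees surfM) -sum_nat_const.
  by apply: eq_big => // v _; rewrite Hq.
rewrite -[RHS](sum_vertex_degrees (dual_surface surfM)) -sum_nat_const.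
by apply: eq_big => // f _; rewrite -(Hp f).
Qed.

(** Euler's formula gives [n * D = 4 * p] for [D = p * q - 2 * p - 2 * q], while
    the star of a vertex needs [n > q * (p - 2) = D + 2 * p] vertices: so
    [D = 1], that is [(p - 2) * (q - 2) = 5]. *)
Lemma equivelar_char_m2_types (p q n e f : nat) :
  2 < p -> 2 < q -> n * q = e.*2 -> f * p = e.*2 -> n + f + 2 = e ->
  q * (p - 2) < n ->
  [/\ p = 3, q = 7 & n = 12] \/ [/\ p = 7, q = 3 & n = 28].
Proof.
move=> p3 q3 nq fp euler star.
case: p p3 fp star => [|[|a]] // a1 fp star; case: q q3 nq star => [|[|b]] // b1 nq star.
have {}star : b.+2 * a < n by move: star; rewrite !subSS subn0.
have key : n * (a * b) = n * 4 + 4 * a.+2.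
  have : n * b.+2 * a.+2 = 2 * a.+2 * n + 2 * (f * a.+2) + 4 * a.+2 by nia.
  nia.
have ab4 : 4 < a * b by nia.
have ab : a * b = 5 by nia.
have : a %| 5 by rewrite -ab dvdn_mulr.
rewrite dvdn_divisors // !inE => /orP[] /eqP Ea; [left|right]; split; nia.
Qed.

Lemma equivelar_polyhedral_types (p q : nat) (M : cell_complex) :
  is_surface_map M -> polyhedral M -> euler_char M = (2 - 4%:Z)%R ->
  equivelar_type p q M ->
  [/\ p = 3, q = 7 & #|vertex M| = 12] \/ [/\ p = 7, q = 3 & #|vertex M| = 28].
Proof.
move=> surfM polyM eulerM typeM; have [p3 q3 Hp Hq] := typeM.
have [nq fp] := equivelar_counts surfM typeM.
apply: (equivelar_char_m2_types p3 q3 nq fp).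
  by move: eulerM; rewrite /euler_char; lia.
have [/set0Pn[v _] _] := skeleton_connected surfM.
have polygon3 (f : polygon M) : 2 < #|polygon_edges f| by rewrite Hp.
have := star_bound surfM polyM polygon3 v.
rewrite (eq_bigr (fun=> p.-1)) => [|f _]; last by rewrite Hp.
rewrite sum_nat_const card_polygons_around // Hq.
have : 0 < #|vertex M| by apply/card_gt0P; exists v.
nia.
Qed.

(** * Duality and orientability *)

(** If an oriented polygon traverses [e] towards [v], orient the dual edge towards
    that polygon on the boundary of the dual polygon [v]. *)
Lemma dual_orientable (M : cell_complex) :
  is_surface_map M -> orientable M -> orientable (dual M).
Proof.
move=> surfM [head [head_end head_inj head_opp]].
pose side (v : vertex M) (e : edge M) : polygon M :=
  odflt (xchoose (edge_side surfM e)) [pick f | inc_ep e f && (head f e == v)].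
have sideP v e : inc_ve v e -> inc_ep e (side v e) /\ head (side v e) e = v.
  move=> ve; rewrite /side; case: pickP => [f /andP[ef /eqP]|none] //=.
  have [f ef] := edge_side surfM e.
  have := edge_sides surfM e; rewrite (cardsD1 f) inE ef => -[Eg].
  have /cards1P[g /setP/(_ g)] : #|polygons_at e :\ f| == 1 by apply/eqP.
  rewrite !inE eqxx => /andP[gf eg].
  have [fv gv] : head f e != v /\ head g e != v.
    by have := none f; have := none g; rewrite ef eg /= => -> ->.
  have fg : f != g by rewrite eq_sym.
  have := card2_eq (edge_two_ends surfM e) _ _ (head_opp e f g fg ef eg).
  rewrite !inE !head_end // => /(_ isT isT)/setP/(_ v).
  by rewrite !inE ve ![v == _]eq_sym (negPf fv) (negPf gv).
exists side; split.
- by move=> v e ve; case: (sideP v e ve).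
- move=> v e e'; rewrite !inE => ve ve' ss.
  have [es hs] := sideP v e ve; have [es' hs'] := sideP v e' ve'.
  by apply: (head_inj (side v e)); rewrite ?inE ?hs // ss.
- move=> e u v uv ue ve; apply: contraNneq uv => ss.
  have [_ <-] := sideP u e ue; have [_ <-] := sideP v e ve.
  by rewrite ss.
Qed.

Lemma dual_nonorientable_surface (g : nat) (M : cell_complex) :
  on_nonorientable_surface g M -> on_nonorientable_surface g (dual M).
Proof.
move=> [surfM norM eulerM]; split; first exact: dual_surface.
  move=> orM; apply: norM; rewrite -(dualK M).
  by apply: dual_orientable => //; apply: dual_surface.
by rewrite -eulerM /euler_char /=; lia.
Qed.

Lemma dual_isomorphic (M N : cell_complex) :
  isomorphic M N -> isomorphic (dual M) (dual N).
Proof.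
move=> [phi0 [phi1 [phi2 [bij0 bij1 bij2 iso01 iso12]]]].
by exists phi2, phi1, phi0; split=> //= x y; rewrite ?iso01 ?iso12.
Qed.

Lemma isomorphic_sym (M N : cell_complex) : isomorphic M N -> isomorphic N M.
Proof.
move=> [phi0 [phi1 [phi2 [[psi0 K0 L0] [psi1 K1 L1] [psi2 K2 L2] iso01 iso12]]]].
exists psi0, psi1, psi2; split; [exact: Bijective L0 K0|exact: Bijective L1 K1|
  exact: Bijective L2 K2| |] => x y.
  by rewrite -iso01 L0 L1.
by rewrite -iso12 L1 L2.
Qed.

(** * Triangulations as ternary relations *)

(** [T a b c] is to be read as: [a], [b] and [c] are the vertices of a triangle.
    The link of [a] is 2-regular on the [d] neighbours of [a], so [tri_link]
    says that it is a single circuit; this form is the one that the pruning of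
    the search contradicts. *)
Record triangulation (d : nat) (V : finType) (T : V -> V -> V -> bool) : Prop :=
  Triangulation {
  tri_rot : forall a b c, T a b c -> T b c a;
  tri_swap : forall a b c, T a b c -> T b a c;
  tri_neq : forall a b c, T a b c -> a != b;
  tri_two : forall a b c, T a b c -> #|[set x | T a b x]| = 2;
  tri_degree : forall a, #|[set b | [exists c, T a b c]]| = d;
  tri_link : forall a (S : {set V}),
    (exists b c, b \in S /\ T a b c) ->
    (forall b c, b \in S -> T a b c -> c \in S) -> d <= #|S|
}.

Lemma card3_third (V : finType) (A : {set V}) (a b : V) :
  #|A| = 3 -> a \in A -> b \in A -> a != b ->
  exists x, [/\ x != a, x != b & A = [set a; b; x]].
Proof.
move=> A3 aA bA ab.
have bA' : b \in A :\ a by rewrite !inE eq_sym ab.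
move: A3; rewrite (cardsD1 a) aA (cardsD1 b) bA' !add1n => -[Ex].
have /cards1P[x Dx] : #|(A :\ a) :\ b| == 1 by apply/eqP.
exists x; have := set11 x; rewrite -Dx !inE => /and3P[xb xa _]; split=> //.
by rewrite -setUA (setD1K bA') (setD1K aA).
Qed.

Lemma set3_card (V : finType) (a b c : V) :
  uniq [:: a; b; c] -> #|[set a; b; c]| = 3.
Proof.
rewrite /= !inE negb_or !andbT => /andP[/andP[ab ac] bc].
by rewrite setUC cardsU1 !inE negb_or cards2 ab ![c == _]eq_sym ac bc.
Qed.

Lemma uniq3 (V : eqType) (a b c : V) :
  uniq [:: a; b; c] = [&& a != b, a != c & b != c].
Proof. by rewrite /= !inE negb_or !andbT andbA. Qed.

Lemma card3_eq (V : finType) (A : {set V}) (a b c : V) :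
  #|A| = 3 -> a \in A -> b \in A -> c \in A -> uniq [:: a; b; c] ->
  A = [set a; b; c].
Proof.
move=> A3 aA bA cA abc; apply/esym/eqP; rewrite eqEcard A3 set3_card // andbT.
by apply/subsetP => z; rewrite !inE => /orP[/orP[]|] /eqP ->.
Qed.

Lemma set3_rot (V : finType) (a b c : V) : [set a; b; c] = [set b; c; a].
Proof. by rewrite -setUA setUC. Qed.

Lemma set3_swap (V : finType) (a b c : V) : [set a; b; c] = [set b; a; c].
Proof. by rewrite [[set a; b]]setUC. Qed.

Section TriangulationTheory.

Variables (d : nat) (V : finType) (T : V -> V -> V -> bool).
Hypothesis triT : triangulation d T.

Lemma tri_uniq a b c : T a b c -> uniq [:: a; b; c].
Proof.
move=> abc; have bca := tri_rot triT abc; have cab := tri_rot triT bca.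
by rewrite uniq3 (tri_neq triT abc) (tri_neq triT bca) eq_sym (tri_neq triT cab).
Qed.

Lemma tri_set3 a b c x y z :
  T a b c -> [set a; b; c] = [set x; y; z] -> uniq [:: x; y; z] -> T x y z.
Proof.
move=> abc /setP E; rewrite uniq3 => /and3P[xy xz yz].
have bca := tri_rot triT abc; have cab := tri_rot triT bca.
have bac := tri_swap triT abc; have cba := tri_swap triT bca.
have acb := tri_swap triT cab.
have := E z; have := E y; have := E x; rewrite !inE !eqxx ?orbT /=.
by do 3!(case/orP => [/orP[]|] /eqP ?); subst; rewrite ?eqxx in xy xz yz *.
Qed.

End TriangulationTheory.

(** * The triangulation of a polyhedral map by triangles *)

Definition tri (M : cell_complex) (a b c : vertex M) : bool :=
  uniq [:: a; b; c] && [exists f, polygon_vertices f == [set a; b; c]].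

Section TriangularMaps.

Variables (d : nat) (M : cell_complex).
Hypotheses (surfM : is_surface_map M) (polyM : polyhedral M).
Hypothesis typeM : equivelar_type 3 d M.

Implicit Types (a b c : vertex M) (e : edge M) (f : polygon M).

Let card_edges (f : polygon M) : #|polygon_edges f| = 3.
Proof. by case: typeM. Qed.

Let card_degree (v : vertex M) : #|edges_at v| = d.
Proof. by case: typeM. Qed.

Let polygon3 (f : polygon M) : 2 < #|polygon_edges f|.
Proof. by rewrite card_edges. Qed.

Let card_polygon (f : polygon M) : #|polygon_vertices f| = 3.
Proof. by rewrite card_polygon_vertices. Qed.

Lemma tri_polygon (f : polygon M) a b : a != b ->
  a \in polygon_vertices f -> b \in polygon_vertices f ->
  exists2 c, tri a b c & polygon_vertices f = [set a; b; c].
Proof.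
move=> ab af bf; have [c [ca cb Ef]] := card3_third (card_polygon f) af bf ab.
exists c => //; rewrite /tri uniq3 ab ![_ == c]eq_sym ca cb.
by apply/existsP; exists f; rewrite Ef.
Qed.

Lemma polygon_vertices_inj : injective (@polygon_vertices M).
Proof.
move=> f g fg; apply/eqP/contraT => ne; have := polyM ne => /=.
rewrite fg setIid; have := card_polygon g.
by move=> cg [[Eg _]|[v [Eg _]]|[e [Eg _]]]; move: cg;
  rewrite Eg ?cards0 ?cards1 ?(edge_two_ends surfM).
Qed.

(** At either of two vertices of a triangle there are two of its three edges, so
    one edge is at both. *)
Lemma triangle_edge (f : polygon M) a b : a != b ->
  a \in polygon_vertices f -> b \in polygon_vertices f ->
  exists2 e, inc_ep e f & edge_ends e = [set a; b].
Proof.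
move=> ab af bf.
have Ea := polygon_degree surfM af; have Eb := polygon_degree surfM bf.
have : 0 < #|(edges_at a :&: polygon_edges f) :&: (edges_at b :&: polygon_edges f)|.
  have := cardsUI (edges_at a :&: polygon_edges f) (edges_at b :&: polygon_edges f).
  rewrite Ea Eb.
  suff : #|edges_at a :&: polygon_edges f :|: edges_at b :&: polygon_edges f| <= 3 by lia.
  by rewrite -(card_edges f) subset_leq_card // subUset !subsetIr.
case/card_gt0P => e; rewrite !inE => /andP[/andP[ae ef] /andP[be _]].
exists e => //.
by apply: card2_eq (edge_two_ends surfM e) _ _ ab; rewrite inE.
Qed.

Lemma side_polygon (e : edge M) (f : polygon M) a b :
  edge_ends e = [set a; b] -> inc_ep e f ->
  a \in polygon_vertices f /\ b \in polygon_vertices f.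
Proof.
move=> Ee ef; have inE' x : x \in edge_ends e -> x \in polygon_vertices f.
  by rewrite inE => xe; apply/polygon_verticesP; exists e.
by split; apply: inE'; rewrite Ee !inE eqxx ?orbT.
Qed.

Lemma triE (f : polygon M) a b c :
  polygon_vertices f = [set a; b; c] -> tri a b c = uniq [:: a; b; c].
Proof.
move=> Ef; rewrite /tri andb_idr // => _; apply/existsP; exists f.
by rewrite Ef.
Qed.

Lemma tri_edge a b c : tri a b c ->
  exists (f : polygon M) (e : edge M),
    [/\ polygon_vertices f = [set a; b; c], edge_ends e = [set a; b]
                & inc_ep e f].
Proof.
move=> /andP[]; rewrite uniq3 => /and3P[ab _ _] /existsP[f /eqP Ef].
have [||e ef Ee] := @triangle_edge f a b ab; try by rewrite Ef !inE eqxx ?orbT.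
by exists f, e.
Qed.

Lemma edge_neq (e : edge M) a b : edge_ends e = [set a; b] -> a != b.
Proof.
by move=> Ee; have := edge_two_ends surfM e; rewrite Ee cards2; case: eqP.
Qed.

(** Mapping a side of the edge [ab] to its third vertex is a bijection; the double
    count of its graph says so without choosing the edge [ab]. *)
Lemma tri_two_map a b c : tri a b c -> #|[set x | tri a b x]| = 2.
Proof.
move=> abc; have [f [e [Ef Ee ef]]] := tri_edge abc.
have ab := edge_neq Ee.
have := double_count (polygons_at e) [set x | tri a b x]
  (fun h x => polygon_vertices h == [set a; b; x]).
rewrite (eq_bigr (fun=> 1)) => [|h].
  rewrite sum1_card (edge_sides surfM) [RHS](eq_bigr (fun=> 1)) ?sum1_card //.
  move=> x; rewrite inE => abx; have [h [_ [Eh _ _]]] := tri_edge abx.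
  apply/eqP/cards1P; exists h; apply/setP => g; rewrite !inE -Eh.
  apply/andP/eqP => [[_ /eqP] /polygon_vertices_inj //|->]; split=> //.
  apply: (edge_in_polygon surfM polyM polygon3); rewrite Ee Eh.
  by apply/subsetP => y; rewrite !inE => ->.
rewrite inE => eh; have [ah bh] := side_polygon Ee eh.
have [x abx Eh] := tri_polygon ab ah bh.
apply/eqP/cards1P; exists x; apply/setP => y; rewrite !inE.
apply/andP/eqP => [[/andP[]]|->]; last by rewrite Eh.
rewrite uniq3 Eh => /and3P[_ ay byy] _ /eqP/setP/(_ y).
by rewrite !inE eqxx orbT ![y == _]eq_sym (negPf ay) (negPf byy) /= => /eqP.
Qed.

Lemma tri_degree_map a : #|[set b | [exists c, tri a b c]]| = d.
Proof.
rewrite -(card_degree a).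
have := double_count (edges_at a) [set b | [exists c, tri a b c]]
  (fun e b => edge_ends e == [set a; b]).
rewrite (eq_bigr (fun=> 1)) => [|e]; last first.
  rewrite inE => ae; have [b ba Ee] := other_end surfM ae.
  have [f ef] := edge_side surfM e; have [af bf] := side_polygon Ee ef.
  have ab : a != b by rewrite eq_sym.
  have [c abc _] := tri_polygon ab af bf.
  apply/eqP/cards1P; exists b; apply/setP => x; rewrite !inE Ee.
  apply/andP/eqP => [[_ /eqP/setP/(_ b)]|->].
    by rewrite !inE eqxx orbT (negPf ba) => /esym/eqP.
  by split=> //; apply/existsP; exists c.
rewrite sum1_card [RHS](eq_bigr (fun=> 1)) ?sum1_card //.
move=> b; rewrite inE => /existsP[c /tri_edge[f [e [Ef Ee ef]]]].
apply/eqP/cards1P; exists e; apply/setP => e'; rewrite !inE -Ee.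
apply/andP/eqP => [[_ /eqP]|->]; first exact: edge_ends_inj.
by split=> //; have /setP/(_ a) := Ee; rewrite !inE eqxx.
Qed.

(** The edges that join [a] to the members of a closed set are closed under
    crossing the corners at [a]. *)
Lemma tri_link_map a (S : {set vertex M}) :
  (exists b c, b \in S /\ tri a b c) ->
  (forall b c, b \in S -> tri a b c -> c \in S) -> d <= #|S|.
Proof.
move=> [b0 [c0 [b0S abc0]]] clS; rewrite -(tri_degree_map a).
apply: subset_leq_card.
have /subsetP all_edges : edges_at a \subset
    [set e | [exists x in S, edge_ends e == [set a; x]]].
  apply: (connected_on_closed (link_connected surfM a)).
    have [f [e [_ Ee _]]] := tri_edge abc0; exists e.
      by have /setP/(_ a) := Ee; rewrite !inE eqxx.
    by rewrite inE; apply/exists_inP; exists b0 => //; rewrite Ee.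
  move=> e e' _; rewrite !inE => ae' /exists_inP[x xS /eqP Ee].
  case/existsP => f /andP[ef e'f]; have [y ya Ee'] := other_end surfM ae'.
  apply/exists_inP; exists y; last by rewrite Ee'.
  have [<- //|xy] := eqVneq x y.
  have ax := edge_neq Ee; have [af xf] := side_polygon Ee ef.
  have [_ yf] := side_polygon Ee' e'f.
  apply: (clS x) => //; rewrite (@triE f).
    by rewrite uniq3 ax xy eq_sym ya.
  by apply: card3_eq (card_polygon f) _ _ _ _ => //; rewrite uniq3 ax xy eq_sym ya.
apply/subsetP => b; rewrite inE => /existsP[c /tri_edge[f [e [_ Ee _]]]].
have : e \in edges_at a by have /setP/(_ a) := Ee; rewrite !inE eqxx.
move/all_edges; rewrite inE => /exists_inP[x xS /eqP].
rewrite Ee => /setP/(_ b); rewrite !inE eqxx orbT.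
by rewrite eq_sym (negPf (edge_neq Ee)) => /esym/eqP->.
Qed.

Lemma map_triangulation : triangulation d (@tri M).
Proof.
split.
- move=> a b c /andP[abc /existsP[f /eqP Ef]]; rewrite (@triE f).
    by rewrite -(rot_uniq 2).
  by rewrite Ef set3_rot.
- move=> a b c /andP[abc /existsP[f /eqP Ef]]; rewrite (@triE f).
    by move: abc; rewrite !uniq3 eq_sym => /and3P[-> -> ->].
  by rewrite Ef set3_swap.
- by move=> a b c /andP[]; rewrite uniq3 => /and3P[].
- exact: tri_two_map.
- exact: tri_degree_map.
- exact: tri_link_map.
Qed.

End TriangularMaps.

(** * Orientations of triangulations *)

Definition orientation (V : finType) (T o : V -> V -> V -> bool) : Prop :=
  forall a b c, T a b c ->
    [/\ o b c a = o a b c, o b a c = ~~ o a b c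
      & forall x, T a b x -> x != c -> o a b x = ~~ o a b c].

Section OrientationOfMaps.

Variables (d : nat) (M : cell_complex).
Hypotheses (surfM : is_surface_map M) (polyM : polyhedral M).
Hypothesis typeM : equivelar_type 3 d M.

Implicit Types (a b c : vertex M) (e : edge M) (f : polygon M).

Let triM : triangulation d (@tri M) := map_triangulation surfM polyM typeM.

Let polygon_inj : injective (@polygon_vertices M) :=
  @polygon_vertices_inj d M surfM polyM typeM.

Let edge_inj : injective (@edge_ends M).
Proof.
apply: edge_ends_inj => // f; case: typeM => _ _ -> //.
Qed.

(** [o a b c] says that the oriented triangle [abc] traverses [ab] towards [b].
    The three edges of a triangle have three different heads, so [o] is
    invariant under rotation. *)
Lemma orientable_orientation :
  orientable M -> exists o, orientation (@tri M) o.
Proof.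
move=> [head [head_end head_inj head_opp]].
pose o a b c := [exists f, exists e, [&& polygon_vertices f == [set a; b; c],
  edge_ends e == [set a; b] & head f e == b]].
have oE a b c f e : polygon_vertices f = [set a; b; c] ->
    edge_ends e = [set a; b] -> o a b c = (head f e == b).
  move=> Ef Ee; apply/existsP/idP => [[f' /existsP[e' /and3P[/eqP Ef' /eqP Ee']]]|hb].
    by rewrite (polygon_inj (etrans Ef (esym Ef'))) (edge_inj (etrans Ee (esym Ee'))).
  by exists f; apply/existsP; exists e; rewrite Ef Ee !eqxx.
have headP f e a b : edge_ends e = [set a; b] -> inc_ep e f ->
    (head f e == a) = ~~ (head f e == b).
  move=> Ee ef; have := edge_neq surfM Ee.
  have := head_end f e ef; have /setP/(_ (head f e)) := Ee; rewrite !inE => ->.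
  by case/orP => /eqP->; rewrite eqxx ?[b == a]eq_sym; case: eqP.
exists o => a b c abc.
have [f [e1 [Ef Ee1 e1f]]] := tri_edge surfM typeM abc.
have bca := tri_rot triM abc; have cab := tri_rot triM bca.
have Ef2 : polygon_vertices f = [set b; c; a] by rewrite Ef set3_rot.
have Ef3 : polygon_vertices f = [set c; a; b] by rewrite Ef2 set3_rot.
have af : a \in polygon_vertices f by rewrite Ef !inE eqxx.
have bf : b \in polygon_vertices f by rewrite Ef2 !inE eqxx.
have cf : c \in polygon_vertices f by rewrite Ef3 !inE eqxx.
have [e2 e2f Ee2] := triangle_edge surfM typeM (tri_neq triM bca) bf cf.
have [e3 e3f Ee3] := triangle_edge surfM typeM (tri_neq triM cab) cf af.
have diff e e' x y : edge_ends e = [set x; y] -> edge_ends e' = [set x; y] -> e = e'.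
  by move=> Ee Ee'; apply: edge_inj; rewrite Ee.
have inj e e' : inc_ep e f -> inc_ep e' f -> head f e = head f e' ->
    edge_ends e = edge_ends e'.
  by move=> ef e'f ee'; rewrite (head_inj f e e') ?inE.
have ab := tri_neq triM abc; have bc := tri_neq triM bca.
have ca := tri_neq triM cab.
have nh12 : ~~ ((head f e1 == b) && (head f e2 == b)).
  apply/andP => -[/eqP h1 /eqP h2]; have := inj e1 e2 e1f e2f (etrans h1 (esym h2)).
  rewrite Ee1 Ee2 => /setP/(_ a); rewrite !inE eqxx (negPf ab) eq_sym.
  by rewrite (negPf ca).
have nh31 : ~~ ((head f e3 == a) && (head f e1 == a)).
  apply/andP => -[/eqP h3 /eqP h1]; have := inj e3 e1 e3f e1f (etrans h3 (esym h1)).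
  rewrite Ee1 Ee3 => /setP/(_ b); rewrite !inE eqxx ![b == _]eq_sym (negPf ab).
  by rewrite eq_sym (negPf bc) orbT.
have nh23 : ~~ ((head f e2 == c) && (head f e3 == c)).
  apply/andP => -[/eqP h2 /eqP h3]; have := inj e2 e3 e2f e3f (etrans h2 (esym h3)).
  rewrite Ee2 Ee3 => /setP/(_ a); rewrite !inE eqxx ![a == _]eq_sym (negPf ca) orbT.
  by rewrite eq_sym (negPf ab).
split.
- rewrite (oE _ _ _ f e2) // (oE _ _ _ f e1) //.
  move: nh12 nh31 nh23; rewrite (headP f e2 _ _ Ee2 e2f) (headP f e1 _ _ Ee1 e1f).
  rewrite (headP f e3 _ _ Ee3 e3f).
  by case: (head f e1 == b); case: (head f e2 == c); case: (head f e3 == a).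
- have Ef' : polygon_vertices f = [set b; a; c] by rewrite Ef set3_swap.
  have Ee1' : edge_ends e1 = [set b; a] by rewrite Ee1 setUC.
  rewrite (oE _ _ _ _ _ Ef' Ee1') (oE _ _ _ _ _ Ef Ee1).
  exact: headP.
- move=> x abx xc; have [g [e [Eg Ee eg]]] := tri_edge surfM typeM abx.
  rewrite (diff e e1 a b Ee Ee1) in eg.
  have fg : f != g.
    apply: contraNneq xc => fg; have /setP/(_ x) := Eg; rewrite -fg Ef !inE eqxx.
    have := tri_uniq triM abx; rewrite uniq3 => /and3P[_ ax bx].
    by rewrite ![x == _]eq_sym (negPf ax) (negPf bx) orbT => /eqP->.
  rewrite (oE _ _ _ g e1) // (oE _ _ _ f e1) //.
  have fg1 := head_opp e1 f g fg e1f eg.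
  have := headP f e1 a b Ee1 e1f; have := headP g e1 a b Ee1 eg.
  have [hf|hf] := eqVneq (head f e1) b; have [hg|hg] := eqVneq (head g e1) b => //=.
    by rewrite hf hg eqxx in fg1.
  by move=> /eqP hga /eqP hfa; rewrite hga hfa eqxx in fg1.
Qed.

(** The head of an edge of a triangle is the vertex towards which [o] traverses
    it; the default value is only ever taken for an edge outside the polygon. *)
Lemma orientation_orientable o : orientation (@tri M) o -> orientable M.
Proof.
move=> oP.
pose head f e := odflt (xchoose (edge_end surfM e)) [pick v | [exists u, exists w,
  [&& edge_ends e == [set u; v], polygon_vertices f == [set u; v; w],
      tri u v w & o u v w]]].
have head_edge f e : inc_ve (head f e) e.
  rewrite /head; case: pickP => [v /existsP[u /existsP[w /and4P[/eqP Ee _ _ _]]]|_].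
    by have /setP/(_ v) := Ee; rewrite !inE eqxx orbT.
  exact: (xchooseP (edge_end surfM e)).
have headE f e a b c : edge_ends e = [set a; b] ->
    polygon_vertices f = [set a; b; c] -> tri a b c -> o a b c -> head f e = b.
  move=> Ee Ef abc oabc; rewrite /head; case: pickP => [v|/(_ b)/existsP[]] /=; last first.
    by exists a; apply/existsP; exists c; rewrite Ee Ef !eqxx abc.
  case/existsP => u /existsP[w /and4P[/eqP Ee' /eqP Ef' uvw ouvw]].
  have : v \in [set a; b] by rewrite -Ee Ee' !inE eqxx orbT.
  rewrite !inE => /orP[] /eqP // va; subst v.
  have ub : u = b.
    have : u \in [set a; b] by rewrite -Ee Ee' !inE eqxx.
    by rewrite !inE (negPf (tri_neq triM uvw)) => /eqP.
  subst u; have [_ obac _] := oP _ _ _ abc.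
  have wc : w = c.
    have : w \in [set a; b; c] by rewrite -Ef Ef' !inE eqxx orbT.
    have := tri_uniq triM uvw; rewrite uniq3 !inE => /and3P[_ bw aw].
    by rewrite ![w == _]eq_sym (negPf aw) (negPf bw) /= => /eqP.
  by rewrite wc obac oabc in ouvw.
have headN f e a b c : edge_ends e = [set a; b] ->
    polygon_vertices f = [set a; b; c] -> tri a b c ->
    head f e = if o a b c then b else a.
  move=> Ee Ef abc; case: ifP => oabc; first exact: headE oabc.
  apply: (@headE f e b a c); rewrite ?Ee ?Ef ?[[set a; b]]setUC //.
    exact: tri_swap triM _ _ _ abc.
  by have [_ -> _] := oP _ _ _ abc; rewrite oabc.
exists head; split=> //.
- move=> f e e'; rewrite !inE => ef e'f ee'.
  have [u uv Ee] := other_end surfM (head_edge f e).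
  have ve' : inc_ve (head f e) e' by rewrite ee'.
  have [w wv Ee'] := other_end surfM ve'.
  have [uw|uw] := eqVneq u w; first by apply: edge_inj; rewrite Ee Ee' uw.
  set v := head f e in uv Ee ve' wv Ee' ee' *.
  have [vf uf] := side_polygon Ee ef; have [_ wf] := side_polygon Ee' e'f.
  have uniq_uvw : uniq [:: u; v; w] by rewrite uniq3 uv uw eq_sym wv.
  have Ef : polygon_vertices f = [set u; v; w].
    apply: card3_eq => //; rewrite card_polygon_vertices //.
    by case: typeM.
  have uvw : tri u v w by rewrite (triE Ef).
  have Ef' : polygon_vertices f = [set w; v; u].
    by rewrite Ef set3_rot set3_swap.
  have wvu : tri w v u.
    by apply: (tri_set3 triM uvw); rewrite -?Ef // uniq3 wv ![w == _]eq_sym uw eq_sym uv.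
  have Eu : head f e = if o u v w then v else u.
    by apply: headN => //; rewrite Ee setUC.
  have Ew : head f e' = if o w v u then v else w.
    by apply: headN => //; rewrite Ee' setUC.
  have [vwu _ _] := oP _ _ _ uvw; have [_ wvu' _] := oP _ _ _ (tri_rot triM uvw).
  move: Eu Ew; rewrite -ee' -/v wvu' vwu.
  by case: (o u v w) => /= [_ Ew|Eu _]; [rewrite Ew eqxx in wv|rewrite -Eu eqxx in uv].
- move=> e f g fg ef eg.
  have [v ve] := edge_end surfM e; have [u uv Ee] := other_end surfM ve.
  have [vf uf] := side_polygon Ee ef; have [vg ug] := side_polygon Ee eg.
  have vu : v != u by rewrite eq_sym.
  have [x vux Ef] := tri_polygon surfM typeM vu vf uf.
  have [y vuy Eg] := tri_polygon surfM typeM vu vg ug.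
  have yx : y != x by apply: contraNneq fg => yx; apply/eqP/polygon_inj; rewrite Ef Eg yx.
  rewrite (headN _ _ _ _ _ Ee Ef vux) (headN _ _ _ _ _ Ee Eg vuy).
  have [_ _ /(_ y vuy yx)->] := oP _ _ _ vux.
  by case: (o v u x); rewrite // eq_sym.
Qed.

End OrientationOfMaps.

(** * The map of a triangulation *)

Section ComplexOf.

Variables (V : finType) (T : V -> V -> V -> bool).

Definition is_edge (e : {set V}) : bool :=
  [exists a, exists b, exists c, T a b c && (e == [set a; b])].

Definition is_triangle (f : {set V}) : bool :=
  [exists a, exists b, exists c, T a b c && (f == [set a; b; c])].

Definition complex_of : cell_complex :=
  @CellComplex V {e : {set V} | is_edge e} {f : {set V} | is_triangle f}
    (fun v e => v \in val e) (fun e f => val e \subset val f).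

Lemma is_edgeP (e : {set V}) :
  reflect (exists a b c, T a b c /\ e = [set a; b]) (is_edge e).
Proof.
apply: (iffP existsP) => [[a /existsP[b /existsP[c /andP[abc /eqP->]]]]|].
  by exists a, b, c.
by move=> [a [b [c [abc ->]]]]; exists a; apply/existsP; exists b; apply/existsP;
  exists c; rewrite abc eqxx.
Qed.

Lemma is_triangleP (f : {set V}) :
  reflect (exists a b c, T a b c /\ f = [set a; b; c]) (is_triangle f).
Proof.
apply: (iffP existsP) => [[a /existsP[b /existsP[c /andP[abc /eqP->]]]]|].
  by exists a, b, c.
by move=> [a [b [c [abc ->]]]]; exists a; apply/existsP; exists b; apply/existsP;
  exists c; rewrite abc eqxx.
Qed.

Variable d : nat.
Hypothesis triT : triangulation d T.

Implicit Types (v : vertex complex_of) (e : edge complex_of).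
Implicit Types (f : polygon complex_of).

Lemma triangle_at f v : v \in val f -> exists b c, T v b c /\ val f = [set v; b; c].
Proof.
case/is_triangleP: (valP f) => [a [b [c [abc ->]]]].
have bca := tri_rot triT abc; have cab := tri_rot triT bca.
rewrite !inE => /orP[/orP[]|] /eqP->.
- by exists b, c.
- by exists c, a; rewrite set3_rot.
- by exists a, b; rewrite 2!set3_rot.
Qed.

Lemma triangle_at2 f a b : a != b -> a \in val f -> b \in val f ->
  exists c, T a b c /\ val f = [set a; b; c].
Proof.
move=> ab af; have [x [y [axy ->]]] := triangle_at af.
rewrite !inE eq_sym (negPf ab) => /orP[] /eqP->; first by exists y.
exists x; split; last by rewrite set3_rot set3_swap -set3_rot.
exact: (tri_rot triT (tri_swap triT axy)).
Qed.

Lemma edge_of_tri a b c : T a b c -> is_edge [set a; b].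
Proof. by move=> abc; apply/is_edgeP; exists a, b, c. Qed.

Lemma triangle_of_tri a b c : T a b c -> is_triangle [set a; b; c].
Proof. by move=> abc; apply/is_triangleP; exists a, b, c. Qed.

Definition edge_of a b c (abc : T a b c) : edge complex_of :=
  exist (fun e : {set V} => is_edge e) _ (edge_of_tri abc).

Definition triangle_of a b c (abc : T a b c) : polygon complex_of :=
  exist (fun f : {set V} => is_triangle f) _ (triangle_of_tri abc).

Lemma complex_edge_ends e : edge_ends e = val e.
Proof. by apply/setP => v; rewrite inE. Qed.

Lemma complex_polygon_vertices f : polygon_vertices f = val f.
Proof.
apply/setP => v; apply/polygon_verticesP/idP => [[e ve /subsetP]|vf]; first exact.
have [b [c [vbc Ef]]] := triangle_at vf.
exists (edge_of vbc); rewrite /= ?Ef; first by rewrite !inE eqxx.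
by apply/subsetP => x; rewrite !inE => ->.
Qed.

Lemma tri_complex a b c : @tri complex_of a b c = T a b c.
Proof.
apply/andP/idP => [[abc /existsP[f /eqP]]|abc].
  rewrite complex_polygon_vertices; case/is_triangleP: (valP f) => [x [y [z [xyz ->]]]].
  by move=> E; apply: (tri_set3 triT xyz E).
split; first exact: (tri_uniq triT abc).
apply/existsP; exists (triangle_of abc).
by rewrite complex_polygon_vertices.
Qed.

Lemma card_complex_edge e : #|val e| = 2.
Proof.
by case/is_edgeP: (valP e) => [a [b [c [/(tri_neq triT) ab ->]]]]; rewrite cards2 ab.
Qed.

Lemma card_complex_triangle f : #|val f| = 3.
Proof.
case/is_triangleP: (valP f) => [a [b [c [/(tri_uniq triT) abc ->]]]].
exact: set3_card.
Qed.

Lemma complex_edge_sides e : #|polygons_at e| = 2.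
Proof.
case/is_edgeP: (valP e) => [a [b [c [abc Ee]]]]; rewrite -(tri_two triT abc).
have := double_count (polygons_at e) [set x | T a b x]
  (fun h x => val h == [set a; b; x]).
rewrite (eq_bigr (fun=> 1)) => [|h]; last first.
  rewrite inE /= Ee subUset !sub1set => /andP[ah bh].
  have [x [abx Eh]] := triangle_at2 (tri_neq triT abc) ah bh.
  apply/eqP/cards1P; exists x; apply/setP => y; rewrite !inE.
  apply/andP/eqP => [[aby]|-> ]; last by rewrite Eh.
  have := tri_uniq triT aby; rewrite uniq3 => /and3P[_ ay byy].
  rewrite Eh => /eqP/setP/(_ y).
  by rewrite !inE eqxx orbT ![y == _]eq_sym (negPf ay) (negPf byy) => /eqP.
rewrite sum1_card [RHS](eq_bigr (fun=> 1)) ?sum1_card //.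
move=> x; rewrite inE => abx; apply/eqP/cards1P.
exists (triangle_of abx); apply/setP => g; rewrite !inE /= -val_eqE.
apply/andP/idP => [[] //|/eqP/= ->]; split=> //; rewrite Ee.
by apply/subsetP => y; rewrite !inE => ->.
Qed.

Lemma complex_polygon_degree f v :
  v \in polygon_vertices f -> #|edges_at v :&: polygon_edges f| = 2.
Proof.
rewrite complex_polygon_vertices => vf; have [b [c [vbc Ef]]] := triangle_at vf.
have vcb := tri_rot triT (tri_swap triT vbc).
have /and3P[vb vc bc] : [&& v != b, v != c & b != c].
  by rewrite -uniq3; apply: (tri_uniq triT vbc).
rewrite (_ : _ :&: _ = [set edge_of vbc; edge_of vcb]).
  rewrite cards2 -val_eqE /=; case: eqP => // /setP/(_ b).
  by rewrite !inE eqxx orbT eq_sym (negPf vb) (negPf bc).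
apply/setP => e; rewrite !inE -![e == _]val_eqE /=.
apply/andP/orP => [[ve /subsetP sub]|[] /eqP->]; last 2 first.
- by rewrite !inE eqxx Ef; split=> //; apply/subsetP => y; rewrite !inE => ->.
- rewrite !inE eqxx Ef; split=> //.
  by apply/subsetP => y; rewrite !inE => /orP[] ->; rewrite ?orbT.
have := card_complex_edge e; rewrite (cardsD1 v) ve add1n => -[Ex].
have /cards1P[x Dx] : #|val e :\ v| == 1 by apply/eqP.
have Ee : val e = [set v; x] by rewrite -Dx setD1K.
have : x \in val f by apply: sub; rewrite Ee !inE eqxx orbT.
have xv : x != v by have := set11 x; rewrite -Dx !inE => /andP[].
by rewrite Ef Ee !inE (negPf xv) => /orP[] /eqP->; [left|right].
Qed.

Lemma complex_polygon_connected f :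
  connected_on (polygon_edges f) [rel e e' | [exists v, inc_ve v e && inc_ve v e']].
Proof.
split=> [|e e'].
  case/is_triangleP: (valP f) => [a [b [c [abc Ef]]]].
  apply/set0Pn; exists (edge_of abc).
  by rewrite inE /= Ef; apply/subsetP => y; rewrite !inE => ->.
rewrite !inE /= => ef e'f; apply: connect1; rewrite /= !inE /= ef e'f /=.
have /subset_leq_card : val e :|: val e' \subset val f by rewrite subUset ef.
rewrite card_complex_triangle; have := cardsUI (val e) (val e').
rewrite !card_complex_edge => UI U3.
have /card_gt0P[v] : 0 < #|val e :&: val e'| by lia.
by rewrite inE => vee'; apply/existsP; exists v.
Qed.

Lemma edge_other_end e v : v \in val e -> exists x c, T v x c /\ val e = [set v; x].
Proof.
case/is_edgeP: (valP e) => [a [b [c [abc ->]]]]; rewrite !inE => /orP[] /eqP->.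
  by exists b, c.
by exists a, c; rewrite setUC; split=> //; apply: (tri_swap triT abc).
Qed.

Hypothesis d_gt0 : 0 < d.

Lemma complex_link_connected v :
  connected_on (edges_at v) [rel e e' | [exists f, inc_ep e f && inc_ep e' f]].
Proof.
have nbr x c (vxc : T v x c) : edge_of vxc \in @edges_at complex_of v.
  by rewrite inE /= !inE eqxx.
apply: closed_connected_on.
  have /card_gt0P[x] : 0 < #|[set b | [exists c, T v b c]]| by rewrite (tri_degree triT).
  rewrite inE => /existsP[c vxc]; apply/set0Pn; by eexists; apply: (nbr x c vxc).
move=> S [e0 ve0 e0S] clS.
pose N := [set x | [exists e in S, val e == [set v; x]]].
have N_sub : N \subset [set b | [exists c, T v b c]].
  apply/subsetP => x; rewrite !inE => /exists_inP[e _ /eqP Ee].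
  have [|y [c [vyc Ee']]] := @edge_other_end e v; first by rewrite Ee !inE eqxx.
  suff -> : x = y by apply/existsP; exists c.
  have vx : v != x by have := card_complex_edge e; rewrite Ee cards2; case: eqP.
  move: Ee'; rewrite Ee => /setP/(_ x); rewrite !inE eqxx orbT eq_sym (negPf vx).
  by move/esym/eqP.
have /eqP NE : N == [set b | [exists c, T v b c]].
  rewrite eqEcard N_sub (tri_degree triT) (tri_link triT (a := v)) //.
    rewrite inE in ve0; have [x [c [vxc Ee]]] := edge_other_end ve0.
    by exists x, c; split=> //; rewrite inE; apply/exists_inP; exists e0; rewrite ?Ee.
  move=> x y; rewrite !inE => /exists_inP[e eS /eqP Ee] vxy.
  have vyx := tri_swap triT (tri_rot triT (tri_rot triT vxy)).
  apply/exists_inP; exists (edge_of vyx) => //.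
  apply: (clS e) => //; first by rewrite inE /= Ee !inE eqxx.
  apply/existsP; exists (triangle_of vxy) => /=.
  by rewrite Ee; apply/andP; split; apply/subsetP => z; rewrite !inE => // /orP[] ->;
    rewrite ?orbT.
apply/subsetP => e; rewrite inE => /edge_other_end[x [c [vxc Ee]]].
have : x \in N by rewrite NE inE; apply/existsP; exists c.
rewrite inE => /exists_inP[e' e'S /eqP Ee'].
by rewrite (_ : e = e') //; apply: val_inj; rewrite Ee Ee'.
Qed.

(** With fewer than [2 * (d + 1)] vertices the closed neighbourhoods of any two
    vertices meet. *)
Hypothesis V_small : 0 < #|V| < (d.+1).*2.

Lemma complex_skeleton_connected :
  connected_on [set: vertex complex_of]
    [rel u v | [exists e, inc_ve u e && inc_ve v e]].
Proof.
have /andP[/card_gt0P[v0 _] V_lt] := V_small.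
apply: closed_connected_on; first by apply/set0Pn; exists v0.
move=> S [u _ uS] clS; apply/subsetP => w _.
pose nbrs a := a |: [set b | [exists c, T a b c]].
have card_nbrs a : #|nbrs a| = d.+1.
  rewrite cardsU1 (tri_degree triT) inE; case: existsP => // -[c].
  by move/(tri_neq triT); rewrite eqxx.
have step a b : b \in nbrs a -> (a \in S) = (b \in S).
  rewrite !inE => /orP[/eqP-> //|/existsP[c abc]].
  have [ae be] : a \in val (edge_of abc) /\ b \in val (edge_of abc).
    by rewrite /= !inE !eqxx orbT.
  apply/idP/idP => xS; [apply: (clS a) => //=|apply: (clS b) => //=].
    by apply/existsP; exists (edge_of abc); rewrite ae.
  by apply/existsP; exists (edge_of abc); rewrite be.
have : 0 < #|nbrs u :&: nbrs w|.
  have := cardsUI (nbrs u) (nbrs w); rewrite !card_nbrs.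
  have := subset_leq_card (subsetT (nbrs u :|: nbrs w)); rewrite cardsT.
  by move: V_lt; rewrite -addnn; lia.
case/card_gt0P => z; rewrite inE => /andP[uz wz].
by rewrite (step _ _ wz) -(step _ _ uz).
Qed.

Lemma complex_surface : is_surface_map complex_of.
Proof.
split.
- by move=> e; rewrite complex_edge_ends card_complex_edge.
- exact: complex_edge_sides.
- exact: complex_polygon_degree.
- exact: complex_polygon_connected.
- exact: complex_link_connected.
- exact: complex_skeleton_connected.
Qed.

Lemma complex_type : 2 < d -> equivelar_type 3 d complex_of.
Proof.
move=> d3; split=> // [f|v].
  by rewrite -(card_polygon_vertices complex_surface) complex_polygon_vertices
    card_complex_triangle.
rewrite -(tri_degree triT v).
have := double_count (edges_at v) [set b | [exists c, T v b c]]
  (fun e b => val e == [set v; b]).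
rewrite (eq_bigr (fun=> 1)) => [|e]; last first.
  rewrite inE => /edge_other_end[x [c [vxc Ee]]].
  apply/eqP/cards1P; exists x; apply/setP => y; rewrite !inE Ee.
  apply/andP/eqP => [[/existsP[z vyz] /eqP/setP/(_ y)]|->].
    by rewrite !inE eqxx orbT eq_sym (negPf (tri_neq triT vyz)) => /eqP.
  by split=> //; apply/existsP; exists c.
rewrite sum1_card [RHS](eq_bigr (fun=> 1)) ?sum1_card //.
move=> x; rewrite inE => /existsP[c vxc]; apply/eqP/cards1P.
exists (edge_of vxc); apply/setP => e; rewrite !inE -val_eqE /=.
by apply/andP/idP => [[]|/eqP->] //; rewrite !inE !eqxx.
Qed.

Lemma complex_polyhedral : polyhedral complex_of.
Proof.
move=> f g fg /=; rewrite !complex_polygon_vertices.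
have : #|val f :&: val g| <= 2.
  rewrite leqNgt; apply: contra fg => I3; apply/eqP/val_inj.
  have sub (A : {set V}) : val f :&: val g \subset A -> #|A| = 3 -> val f :&: val g = A.
    by move=> IA A3; apply/eqP; rewrite eqEcard IA A3.
  have If := sub _ (subsetIl _ _) (card_complex_triangle f).
  have Ig := sub _ (subsetIr _ _) (card_complex_triangle g).
  exact: etrans (esym If) Ig.
have edgesI e : e \in polygon_edges f :&: polygon_edges g ->
    val e \subset val f :&: val g by rewrite !inE subsetI.
have noedge : #|val f :&: val g| < 2 -> polygon_edges f :&: polygon_edges g = set0.
  move=> I2; apply/setP => e; rewrite [in RHS]inE; apply/negP => /edgesI/subset_leq_card.
  by rewrite card_complex_edge leqNgt I2.
case I2 : #|_| => [|[|[|//]]] _.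
- by apply: Or31; split; [apply/eqP; rewrite -cards_eq0 I2|apply: noedge; rewrite I2].
- have /cards1P[v Ev] : #|val f :&: val g| == 1 by apply/eqP.
  by apply: Or32; exists v; split=> //; apply: noedge; rewrite I2.
have /cards2P[a [b [ab Eab]]] : #|val f :&: val g| == 2 by apply/eqP.
have [] : a \in val f :&: val g /\ b \in val f :&: val g.
  by rewrite Eab !inE !eqxx orbT.
rewrite !inE => /andP[af ag] /andP[bf bg].
have [c [abc Ef]] := triangle_at2 ab af bf.
apply: Or33; exists (edge_of abc); rewrite complex_edge_ends; split=> //.
apply/setP => e; rewrite [in RHS]inE -val_eqE; apply/idP/idP => [/edgesI|/eqP/= Ee].
  by rewrite Eab => sub; rewrite eqEcard sub (card_complex_edge e) /= cards2 ab.
by rewrite !inE /= Ee -subsetI Eab.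
Qed.

End ComplexOf.

(** * Isomorphisms and triangulations *)

Lemma isomorphic_tri (M N : cell_complex) : isomorphic M N ->
  exists2 phi : vertex M -> vertex N, bijective phi &
    forall a b c, tri a b c -> tri (phi a) (phi b) (phi c).
Proof.
move=> [phi0 [phi1 [phi2 [bij0 [psi1 K1 L1] bij2 iso01 iso12]]]].
exists phi0 => // a b c /andP[abc /existsP[f /eqP Ef]].
have inj0 := bij_inj bij0; apply/andP; split.
  by rewrite -(map_inj_uniq inj0) in abc.
have vert v : (phi0 v \in polygon_vertices (phi2 f)) = (v \in polygon_vertices f).
  apply/polygon_verticesP/polygon_verticesP => -[e ve ef].
    by exists (psi1 e); rewrite -?iso01 -?iso12 L1.
  by exists (phi1 e); rewrite ?iso01 ?iso12.
apply/existsP; exists (phi2 f); apply/eqP/setP => y.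
by have [psi0 K0 L0] := bij0; rewrite -(L0 y) vert Ef !inE !(inj_eq inj0).
Qed.

(** In a polyhedral map an edge and a polygon are determined by their vertices, and
    [T] tells which pairs and triples of vertices occur. *)
Lemma isomorphic_complex_of (d : nat) (M : cell_complex) (W : finType)
    (T : W -> W -> W -> bool) (phi : W -> vertex M) :
  is_surface_map M -> polyhedral M -> equivelar_type 3 d M ->
  bijective phi -> (forall a b c, tri (phi a) (phi b) (phi c) = T a b c) ->
  isomorphic M (complex_of T).
Proof.
move=> surfM polyM typeM [psi phiK psiK] triT.
have polygon3 (f : polygon M) : 2 < #|polygon_edges f| by case: typeM => _ _ ->.
have preim2 a b : phi @^-1: [set a; b] = [set psi a; psi b].
  by apply/setP => x; rewrite !inE !(can2_eq phiK psiK).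
have preim3 a b c : phi @^-1: [set a; b; c] = [set psi a; psi b; psi c].
  by apply/setP => x; rewrite !inE !(can2_eq phiK psiK).
have triT' a b c : tri a b c = T (psi a) (psi b) (psi c) by rewrite -triT !psiK.
have preim_inj : injective (fun A : {set vertex M} => phi @^-1: A).
  by move=> A B /setP E; apply/setP => x; have := E (psi x); rewrite !inE psiK.
have edgeP (e : edge M) : is_edge T (phi @^-1: edge_ends e).
  have [v ve] := edge_end surfM e; have [u uv Ee] := other_end surfM ve.
  have [f ef] := edge_side surfM e; have [vf uf] := side_polygon Ee ef.
  have vu : v != u by rewrite eq_sym.
  have [c vuc _] := tri_polygon surfM typeM vu vf uf.
  by apply/is_edgeP; exists (psi v), (psi u), (psi c); rewrite -triT' Ee preim2.
have triangleP (f : polygon M) : is_triangle T (phi @^-1: polygon_vertices f).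
  have [e ef] := polygon_edge surfM f.
  have [v ve] := edge_end surfM e; have [u uv Ee] := other_end surfM ve.
  have [vf uf] := side_polygon Ee ef; have vu : v != u by rewrite eq_sym.
  have [c vuc Ef] := tri_polygon surfM typeM vu vf uf.
  by apply/is_triangleP; exists (psi v), (psi u), (psi c); rewrite -triT' Ef preim3.
exists psi, (fun e => Sub _ (edgeP e)), (fun f => Sub _ (triangleP f)).
split.
- exact: Bijective psiK phiK.
- apply: inj_surj_bij => [e e' /(congr1 val)/= /preim_inj|[A Ae]].
    exact: edge_ends_inj.
  have /is_edgeP[a [b [c [abc EA]]]] := Ae.
  have [f [e [_ Ee _]]] : exists (f : polygon M) (e : edge M),
      [/\ polygon_vertices f = [set phi a; phi b; phi c],
          edge_ends e = [set phi a; phi b] & inc_ep e f].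
    by apply: (tri_edge surfM typeM); rewrite triT.
  by exists e; apply: val_inj; rewrite /= Ee preim2 !phiK.
- apply: inj_surj_bij => [f g /(congr1 val)/= /preim_inj|[A Ae]].
    exact: polygon_vertices_inj surfM polyM typeM _ _.
  have /is_triangleP[a [b [c [abc EA]]]] := Ae.
  have /andP[_ /existsP[f /eqP Ef]] : tri (phi a) (phi b) (phi c) by rewrite triT.
  by exists f; apply: val_inj; rewrite /= Ef preim3 !phiK.
- by move=> v e; rewrite /= !inE psiK.
- move=> e f; rewrite /=; apply/idP/idP => [/subsetP sub|ef].
    apply: (edge_in_polygon surfM polyM polygon3); apply/subsetP => v ve.
    by have := sub (psi v); rewrite !inE psiK in ve *; apply.
  apply/subsetP => x; rewrite !inE => xe.
  by apply/polygon_verticesP; exists e.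
Qed.

(** * Partial triangulations *)

(** A set of triangles on numbered vertices, stored for computation: entry [b] of
    row [a] lists the third vertices of the known triangles on the edge [ab], so
    that row [a] is the link of [a].  The same type stores sets of oriented
    triangles. *)
Definition links : Type := seq (seq (seq nat)).

Definition link_at (s : links) (a : nat) : seq (seq nat) := nth [::] s a.
Definition thirds (s : links) (a b : nat) : seq nat := nth [::] (link_at s a) b.

Definition add_third (s : links) (a b c : nat) : links :=
  let t := thirds s a b in
  if has (eqn c) t then s
  else set_nth [::] s a (set_nth [::] (link_at s a) b (c :: t)).

Definition add_oriented (s : links) (a b c : nat) : links :=
  add_third (add_third (add_third s a b c) b c a) c a b.

Definition add_triangle (s : links) (a b c : nat) : links :=
  add_oriented (add_oriented s a b c) b a c.

Definition first_triangle : links := add_triangle [::] 0 1 2.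

Lemma has_eqn (c : nat) (t : seq nat) : has (eqn c) t = (c \in t).
Proof. by rewrite -has_pred1; apply: eq_has => x; rewrite /= eq_sym. Qed.

Lemma thirds0 a b : thirds [::] a b = [::].
Proof. by rewrite /thirds /link_at !nth_nil. Qed.

Lemma thirds_add_third s a b c a' b' : thirds (add_third s a b c) a' b' =
  if [&& a' == a, b' == b & c \notin thirds s a b] then c :: thirds s a b
  else thirds s a' b'.
Proof.
rewrite /add_third has_eqn; have [_|cs] := boolP (c \in _); first by rewrite !andbF.
rewrite {1}/thirds {1}/link_at nth_set_nth /=; have [->|] //= := eqVneq a' a.
by rewrite nth_set_nth /=; case: (b' =P b).
Qed.

Lemma mem_add_third s a b c a' b' c' : c' \in thirds (add_third s a b c) a' b' =
  (c' \in thirds s a' b') || [&& a' == a, b' == b & c' == c].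
Proof.
rewrite thirds_add_third; have [->|_] := eqVneq a' a; last by rewrite orbF.
have [->|_] /= := eqVneq b' b; last by rewrite orbF.
have [cs|] := boolP (c \in _); last by rewrite inE orbC.
by have [->|] := eqVneq c' c; rewrite ?cs ?orbF.
Qed.

Lemma uniq_add_third s a b c :
  (forall x y, uniq (thirds s x y)) -> forall x y, uniq (thirds (add_third s a b c) x y).
Proof.
move=> us x y; rewrite thirds_add_third; case: ifP => // /and3P[_ _ cs].
by rewrite /= cs us.
Qed.

(** The walk from [x] along the known part of the link of [a], in the direction
    away from [prev].  It stops at an open end; on a closed circuit it goes
    around until [n] steps are made. *)
Fixpoint walk (s : links) (a prev x n : nat) : seq nat :=
  x :: (if n is n'.+1 then
          if thirds s a x is [:: y; z]
          then walk s a x (if eqn y prev then z else y) n' else [::]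
        else [::]).

Definition closed_in (s : links) (a : nat) (q : seq nat) : bool :=
  all (fun x => if thirds s a x is [:: y; z]
                then has (eqn y) q && has (eqn z) q else false) q.

Fixpoint degree_le (d : nat) (r : seq (seq nat)) : bool :=
  match r with
  | [::] => true
  | [::] :: r' => degree_le d r'
  | _ :: r' => if d is d'.+1 then degree_le d' r' else false
  end.

Definition size_le2 (t : seq nat) : bool := if t is [:: _, _, _ & _] then false else true.

(** Necessary conditions at the three vertices of the triangle [abc] that was
    added last.  A walk of five steps visits at most six vertices, so it is
    closed only on a circuit of length less than 7. *)
Definition admissible (s : links) (a b c : nat) : bool :=
  [&& size_le2 (thirds s a b), size_le2 (thirds s b c), size_le2 (thirds s c a),
      degree_le 7 (link_at s a), degree_le 7 (link_at s b), degree_le 7 (link_at s c),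
      ~~ closed_in s a (walk s a b b 5), ~~ closed_in s b (walk s b c c 5)
    & ~~ closed_in s c (walk s c a a 5)].

Lemma size_walk s a prev x n : size (walk s a prev x n) <= n.+1.
Proof.
elim: n prev x => [|n IHn] prev x //=; rewrite ltnS.
by case: (thirds s a x) => [|y [|z []]].
Qed.

Lemma degree_leE d r : degree_le d r = (count (fun t => t != [::]) r <= d).
Proof.
by elim: r d => [|[|x t] r IHr] [|d] //=; rewrite IHr ?add0n ?add1n.
Qed.

Section Realization.

Variables (V : finType) (T : V -> V -> V -> bool) (x0 : V).
Hypothesis triT : triangulation 7 T.

(** Vertex [a] of [s] stands for entry [a] of [e].  As new vertices take the next
    number, discovering one appends it to [e]. *)
Definition realizes (e : seq V) (s : links) : Prop :=
  [/\ uniq e, forall a b, uniq (thirds s a b)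
    & forall a b c, c \in thirds s a b ->
        [/\ a < size e, b < size e, c < size e
          & T (nth x0 e a) (nth x0 e b) (nth x0 e c)]].

Lemma realizes_nil e : uniq e -> realizes e [::].
Proof. by move=> ue; split=> // a b; rewrite thirds0. Qed.

Lemma realizes_add_third e s a b c :
  a < size e -> b < size e -> c < size e ->
  T (nth x0 e a) (nth x0 e b) (nth x0 e c) ->
  realizes e s -> realizes e (add_third s a b c).
Proof.
move=> ae be ce abc [ue us es]; split=> // [|a' b' c']; first exact: uniq_add_third.
by rewrite mem_add_third => /orP[/es //|/and3P[/eqP-> /eqP-> /eqP->]].
Qed.

Lemma realizes_add_oriented e s a b c :
  a < size e -> b < size e -> c < size e ->
  T (nth x0 e a) (nth x0 e b) (nth x0 e c) ->
  realizes e s -> realizes e (add_oriented s a b c).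
Proof.
move=> ae be ce abc es; have bca := tri_rot triT abc.
have cab := tri_rot triT bca.
by do 2!apply: realizes_add_third => //; apply: realizes_add_third.
Qed.

Lemma realizes_add_triangle e s a b c :
  a < size e -> b < size e -> c < size e ->
  T (nth x0 e a) (nth x0 e b) (nth x0 e c) ->
  realizes e s -> realizes e (add_triangle s a b c).
Proof.
move=> ae be ce abc es; apply: realizes_add_oriented => //.
  exact: (tri_swap triT abc).
exact: realizes_add_oriented.
Qed.

Lemma realizes_rcons e s x : x \notin e -> realizes e s -> realizes (rcons e x) s.
Proof.
move=> xe [ue us es]; split=> // [|a b c /es[ae be ce abc]].
  by rewrite rcons_uniq xe.
by rewrite size_rcons !ltnS !nth_rcons ae be ce; split=> //; apply: ltnW.
Qed.

Lemma realizes_first_triangle x y z : T x y z -> realizes [:: x; y; z] first_triangle.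
Proof.
move=> xyz; apply: realizes_add_triangle => //; apply: realizes_nil.
exact: (tri_uniq triT xyz).
Qed.

Section Admissible.

Variables (e : seq V) (s : links).
Hypothesis es : realizes e s.

Let lab a := nth x0 e a.

Lemma lab_inj : {in [pred a | a < size e] &, injective lab}.
Proof.
have [ue _ _] := es; move=> a b; rewrite !inE => ae be /eqP.
by rewrite /lab nth_uniq // => /eqP.
Qed.

Lemma map_lab_uniq t : uniq t -> all (fun a => a < size e) t -> uniq (map lab t).
Proof.
move=> ut /allP te; rewrite map_inj_in_uniq // => a b /te ae /te be.
exact: lab_inj.
Qed.

Lemma map_lab_bound t (A : {set V}) : uniq t ->
  (forall a, a \in t -> a < size e /\ lab a \in A) -> size t <= #|A|.
Proof.
move=> ut tA; have u : uniq (map lab t).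
  by apply: map_lab_uniq => //; apply/allP => a /tA[].
rewrite -(size_map lab) -(card_uniqP u).
by apply: subset_leq_card; apply/subsetP => _ /mapP[a /tA[_ aA] ->].
Qed.

Lemma size_thirds a b : size (thirds s a b) <= 2.
Proof.
have [_ us sT] := es; case E: (thirds s a b) => [|c t] //.
have abc : T (lab a) (lab b) (lab c) by have [|] := sT a b c; rewrite ?E ?mem_head.
rewrite -E -(tri_two triT abc); apply: map_lab_bound => // x xs.
by have [_ _ xe abx] := sT _ _ _ xs; rewrite inE.
Qed.

Lemma degree_le_link a : degree_le 7 (link_at s a).
Proof.
have [_ us sT] := es; rewrite degree_leE -(tri_degree triT (lab a)).
rewrite -{1}(mkseq_nth [::] (link_at s a)) count_map -size_filter.
apply: map_lab_bound => [|b]; first by rewrite filter_uniq ?iota_uniq.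
rewrite mem_filter /= -/(thirds s a b) => /andP[].
case E: (thirds s a b) => [|c t] // _ _.
have [|_ be _ abc] := sT a b c; first by rewrite E mem_head.
by split=> //; rewrite inE; apply/existsP; exists (lab c).
Qed.

(** The known neighbours would be closed in the link of [a], which is a circuit
    with seven vertices. *)
Lemma no_short_cycle a b : ~~ closed_in s a (walk s a b b 5).
Proof.
have [_ us sT] := es; have bq : b \in walk s a b b 5 by rewrite /= mem_head.
have := size_walk s a b b 5; move: (walk s a b b 5) bq => q bq q6.
apply/negP => /allP clq.
suff : 7 <= #|[set x in map lab q]|.
  rewrite cardsE leqNgt => /negP; apply; rewrite ltnS.
  by apply: leq_trans (card_size _) _; rewrite size_map.
apply: (tri_link triT (a := lab a)).
  have := clq b bq; case E: (thirds s a b) => [|c t] // _.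
  have [|_ _ _ abc] := sT a b c; first by rewrite E mem_head.
  by exists (lab b), (lab c); split=> //; rewrite inE map_f.
move=> y0 w; rewrite !inE => /mapP[x xq ->] axw; have := clq x xq.
case E: (thirds s a x) => [|y [|z []]] //; rewrite !has_eqn => /andP[yq zq].
have [|_ _ ye axy] := sT a x y; first by rewrite E !inE eqxx.
have [|_ _ ze axz] := sT a x z; first by rewrite E !inE eqxx orbT.
have yz : lab y != lab z.
  by rewrite (inj_in_eq lab_inj) ?inE //; have := us a x; rewrite E /= inE andbT.
have := card2_eq (tri_two triT axw) _ _ yz; rewrite !inE => /(_ axy axz)/setP/(_ w).
by rewrite !inE axw => /esym/orP[] /eqP->; rewrite map_f.
Qed.

Lemma realizes_admissible a b c : admissible s a b c.
Proof.
rewrite /admissible !degree_le_link !no_short_cycle.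
by have := size_thirds a b; have := size_thirds b c; have := size_thirds c a;
  do 3!case: (thirds _ _ _) => [|? [|? []]].
Qed.

(** One of the two triangles on an edge being known, the other one completes it
    with a known vertex or with a new one. *)
Lemma realizes_step a b c : thirds s a b = [:: c] ->
  exists e' j,
    [/\ j \notin [:: a; b; c], j <= size e, size e' = maxn (size e) j.+1
      & realizes e' (add_triangle s a b j)].
Proof.
move=> Ec; have [ue us sT] := es.
have [|ae be ce abc] := sT a b c; first by rewrite Ec mem_head.
have [x abx xc] : exists2 x, T (lab a) (lab b) x & x != lab c.
  have := tri_two triT abc; rewrite (cardsD1 (lab c)) inE abc add1n => -[Ex].
  have /card_gt0P[x] : 0 < #|[set x | T (lab a) (lab b) x] :\ lab c| by rewrite Ex.
  by rewrite !inE => /andP[xc abx]; exists x.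
have /and3P[_ xa xb] : [&& lab a != lab b, lab a != x & lab b != x].
  by rewrite -uniq3; apply: (tri_uniq triT abx).
have notin j : lab j = x -> j \notin [:: a; b; c].
  move=> Ej; rewrite !inE; apply/or3P => -[] /eqP Ej'; subst j.
  - by rewrite Ej eqxx in xa.
  - by rewrite Ej eqxx in xb.
  - by rewrite Ej eqxx in xc.
have [xe|xe] := boolP (x \in e).
  exists e, (index x e); have je := xe; rewrite -index_mem in je.
  split; [by apply: notin; rewrite /lab nth_index|exact: ltnW|by rewrite (maxn_idPl _)|].
  by apply: realizes_add_triangle => //; rewrite nth_index.
have es' := realizes_rcons xe es.
exists (rcons e x), (size e).
rewrite size_rcons (maxn_idPr _) //; split=> //.
  rewrite !inE !gtn_eqF //.
have wide i : i < size e -> i < size (rcons e x) by rewrite size_rcons; apply: leqW.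
apply: realizes_add_triangle => //; try exact: wide.
  by rewrite size_rcons.
by rewrite !nth_rcons ae be ltnn eqxx.
Qed.

End Admissible.
End Realization.

(** * Patterns and the search *)

Fixpoint scan_row (r : seq (seq nat)) (b deg : nat) (o : option nat) :
    nat * option nat :=
  match r with
  | [::] => (deg, o)
  | [::] :: r' => scan_row r' b.+1 deg o
  | [:: _] :: r' => scan_row r' b.+1 deg.+1 (Some b)
  | _ :: r' => scan_row r' b.+1 deg.+1 o
  end.

(** [deg] exceeds by one the degree at the edge [o], so that 0 goes with [None]. *)
Fixpoint open_edge_from (s : links) (a deg : nat) (o : option (nat * nat)) :
    option (nat * nat) :=
  if s is r :: s' then
    if scan_row r 0 0 None is (deg', Some b) then
      if leq deg'.+1 deg then open_edge_from s' a.+1 deg o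
      else open_edge_from s' a.+1 deg'.+1 (Some (a, b))
    else open_edge_from s' a.+1 deg o
  else o.

(** The branching is small where a link is nearly complete, hence the preference
    for a vertex of largest known degree. *)
Definition open_edge (s : links) : option (nat * nat) := open_edge_from s 0 0 None.

(** A pattern grows from the triangle 012: the entry [(a, b, c, k)] continues it
    across the edge [ab] from the known triangle [abc] to the triangle [abk].
    Following a pattern inside other links involves no choice, as [k] has to go
    to the other third vertex of the image of [ab]. *)
Definition pattern : Type := seq (nat * nat * nat * nat).

(** A branch of the search is determined by the third vertices that it chose; its
    code lists them, and decoding recovers the edges. *)
Fixpoint decode_from (s : links) (code : seq nat) : pattern :=
  if code is k :: code' then
    if open_edge s is Some (a, b) then
      (a, b, head 0 (thirds s a b), k) :: decode_from (add_triangle s a b k) code'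
    else [::]
  else [::].

Definition decode (code : seq nat) : pattern := decode_from first_triangle code.

Definition add_flip (s : links) (i : nat * nat * nat * nat) : links :=
  let: (a, b, _, k) := i in add_triangle s a b k.

Definition links_of (p : pattern) : links := foldl add_flip first_triangle p.

Definition add_vertex_count (n : nat) (i : nat * nat * nat * nat) : nat := maxn n i.2.+1.

Definition vertex_count (p : pattern) : nat := foldl add_vertex_count 3 p.

(** [m] gives the images of the vertices of the pattern found so far.  As [find]
    returns [size m] when the vertex reached is not in [m], one comparison with
    [k] tests that it is the image of [k], and that it is new if [k] is. *)
Fixpoint embeds_at (s : links) (p : pattern) (m : seq nat) : bool :=
  if p is (a, b, c, k) :: p' then
    let z := nth 0 m c in
    if [seq x <- thirds s (nth 0 m a) (nth 0 m b) | ~~ eqn x z] is x :: _ then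
      let i := find (eqn x) m in
      if eqn i k then
        embeds_at s p' (if eqn i (size m) then rcons m x else m)
      else false
    else false
  else true.

Definition flags (s : links) : seq (seq nat) :=
  [seq [:: ab.1; ab.2; c] | ab <- [seq (a, b) | a <- iota 0 12, b <- iota 0 12],
                            c <- thirds s ab.1 ab.2].

(** The patterns [ps] that extend [p0] need to be followed only from the few
    triangles from which [p0] can be followed. *)
Definition occurs_beyond (p0 : pattern) (ps : seq pattern) (s : links) : bool :=
  has (fun m => if embeds_at s p0 m then has (embeds_at s ^~ m) ps else false) (flags s).

Definition occurs (ps : seq pattern) (s : links) : bool := occurs_beyond [::] ps s.

(** [k] is the number of vertices of [s].  The conditionals, where boolean
    connectives would do, keep an eager evaluation from exploring branches that
    are already decided. *)
Fixpoint search (stop accept : links -> bool) (fuel k : nat) (s : links) : bool :=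
  if fuel is fuel'.+1 then
    if stop s then true
    else if open_edge s is Some (a, b) then
      if thirds s a b is [:: c] then
        all (fun j =>
          if has (eqn j) [:: a; b; c] then true
          else
            let s' := add_triangle s a b j in
            if admissible s' a b j then search stop accept fuel' (maxn k j.+1) s'
            else true) (iota 0 (minn 12 k.+1))
      else false
    else accept s
  else false.


Lemma find_eqn (x : nat) (m : seq nat) : find (eqn x) m = index x m.
Proof. by apply: eq_find => y; rewrite /= eqE /= [eqn x y]eq_sym. Qed.

Section SearchSoundness.

Variables (V : finType) (T : V -> V -> V -> bool) (x0 : V).
Hypothesis triT : triangulation 7 T.
Hypothesis V12 : #|V| <= 12.

(** Whenever a node of the search is realized, so is one of its children, as the
    missing triangle on the open edge has some third vertex; [Q] is whatever both
    kinds of leaves imply. *)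
Lemma search_sound (Q : Prop) (stop accept : links -> bool) :
  (forall e s, realizes T x0 e s -> stop s -> Q) ->
  (forall e s, realizes T x0 e s -> accept s -> Q) ->
  forall fuel e s, realizes T x0 e s -> search stop accept fuel (size e) s -> Q.
Proof.
move=> stopQ acceptQ; elim=> [|fuel IHfuel] e s es //=.
case: ifP => [stop_s _|_]; first exact: stopQ es stop_s.
case: (open_edge s) => [[a b]|]; last exact: (acceptQ _ _ es).
case Ec: (thirds s a b) => [|c [|]] // /allP children.
have [e' [j [jabc je size_e' es']]] := realizes_step triT es Ec.
have size_e'_12 : size e' <= 12.
  have [ue' _ _] := es'; apply: leq_trans V12.
  by rewrite -(card_uniqP ue') max_card.
have j12 : j < 12 by apply: leq_trans size_e'_12; rewrite size_e' leq_maxr.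
have {children} := children j; rewrite mem_iota leq_min j12 ltnS je => /(_ isT).
rewrite -[[|| _, _, _ | _]]/(has (eqn j) [:: a; b; c]) has_eqn (negPf jabc).
rewrite (realizes_admissible triT es') -size_e'.
exact: IHfuel.
Qed.

(** The pattern can be followed in [s] with every vertex as its own image. *)
Fixpoint follows (s : links) (n : nat) (p : pattern) : bool :=
  if p is (a, b, c, k) :: p' then
    [&& a < n, b < n, c < n & k <= n] &&
    [&& c \in thirds s a b, k \in thirds s a b & k != c] &&
    follows s (maxn n k.+1) p'
  else true.

Definition well_formed (p : pattern) : bool := follows (links_of p) 3 p.

Definition realizable (p : pattern) : Prop :=
  exists2 e, size e = vertex_count p & realizes T x0 e (links_of p).

Lemma embeds_at_realizable e s r p m t :
  realizes T x0 e s -> all (fun a => a < size e) m ->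
  realizes T x0 [seq nth x0 e a | a <- m] t -> follows r (size m) p ->
  embeds_at s p m ->
  exists2 e', size e' = foldl add_vertex_count (size m) p &
    realizes T x0 e' (foldl add_flip t p).
Proof.
move=> es; elim: p m t => [|[[[a b] c] k] p IHp] m t me mt /=.
  by move=> _ _; exists [seq nth x0 e a | a <- m]; rewrite ?size_map.
case/andP => /andP[/and4P[am bm cm km] _] fp.
case Ef: [seq _ <- _ | _] => [|x xs] //; case: eqnP => // Ek.
have : x \in [seq y <- thirds s (nth 0 m a) (nth 0 m b) | ~~ eqn y (nth 0 m c)].
  by rewrite Ef mem_head.
rewrite mem_filter => /andP[_ xs']; have [_ _ /(_ _ _ _ xs')[_ _ xe abx]] := es.
rewrite find_eqn in Ek *.
have [xm|xm] := boolP (x \in m).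
  have km' : k < size m by rewrite -Ek index_mem.
  have -> : eqn (index x m) (size m) = false by apply: ltn_eqF; rewrite index_mem.
  have -> : add_vertex_count (size m) (a, b, c, k) = size m by apply/maxn_idPl.
  apply: IHp => //.
    apply: realizes_add_triangle; rewrite ?size_map //.
    by rewrite !(nth_map 0) // -Ek nth_index.
  by move: fp; rewrite (maxn_idPl _).
have Ek' : k = size m by rewrite -Ek memNindex.
rewrite {k}Ek' in Ek fp km *.
have -> : eqn (index x m) (size m) by rewrite Ek; apply/eqnP.
have -> : add_vertex_count (size m) (a, b, c, size m) = size (rcons m x).
  by rewrite size_rcons; apply/maxn_idPr.
apply: IHp; first by rewrite all_rcons xe.
  rewrite map_rcons; apply: realizes_add_triangle => //.
  - by rewrite size_rcons size_map ltnS ltnW.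
  - by rewrite size_rcons size_map ltnS ltnW.
  - by rewrite size_rcons size_map.
  - by rewrite !nth_rcons size_map am bm ltnn eqxx !(nth_map 0).
  apply: realizes_rcons => //; apply/negP => /mapP[y ym].
  have ye : y < size e by apply: (allP me).
  by move/(lab_inj es); rewrite !inE => /(_ xe ye) xy; rewrite xy ym in xm.
by move: fp; rewrite size_rcons (maxn_idPr _).
Qed.

Lemma flagsP s m : reflect
  (exists a b c, [/\ a < 12, b < 12, c \in thirds s a b & m = [:: a; b; c]])
  (m \in flags s).
Proof.
apply: (iffP allpairsPdep) => [[[a b] [c [ab cs ->]]]|[a [b [c [a12 b12 cs ->]]]]].
  move: ab cs => /allpairsP[[a' b'] [+ + [-> ->]]] cs; rewrite !mem_iota => a12 b12.
  by exists a', b', c.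
exists (a, b), c; split=> //; apply/allpairsP; exists (a, b).
by rewrite !mem_iota.
Qed.

Lemma occurs_realizable p0 ps e s : all well_formed ps ->
  realizes T x0 e s -> occurs_beyond p0 ps s ->
  exists2 p, p \in ps & realizable p.
Proof.
move=> /allP wf es /hasP[m /flagsP[a [b [c [_ _ cs ->]]]]]; case: ifP => // _.
have [_ _ /(_ _ _ _ cs)[ae be ce abc]] := es.
case/hasP => p pps emb; exists p => //.
apply: (@embeds_at_realizable e s (links_of p) p [:: a; b; c]) => //=.
- by rewrite ae be ce.
- exact: realizes_first_triangle.
- exact: wf.
Qed.

Lemma realizable_nil x y z : T x y z -> realizable [::].
Proof. by move=> xyz; exists [:: x; y; z] => //; apply: realizes_first_triangle. Qed.

(** From 1 triangle to 28 a branch has 28 nodes. *)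
Definition explored (stop accept : links -> bool) (p : pattern) : bool :=
  search stop accept 28 (vertex_count p) (links_of p).

Lemma explored_sound (Q : Prop) (stop accept : links -> bool) (p : pattern) :
  (forall e s, realizes T x0 e s -> stop s -> Q) ->
  (forall e s, realizes T x0 e s -> accept s -> Q) ->
  explored stop accept p -> realizable p -> Q.
Proof.
move=> stopQ acceptQ exp [e size_e es]; rewrite /explored -size_e in exp.
exact: search_sound es exp.
Qed.

End SearchSoundness.

(** * Complete triangulations *)

Definition tri_of (s : links) (a b c : 'I_12) : bool := (c : nat) \in thirds s a b.

(** A walk of six steps with seven different vertices goes around the whole link,
    as the number of neighbours is 7. *)
Definition complete_at (s : links) (a b : nat) : bool :=
  let t := thirds s a b in
  (t == [::]) ||
  [&& a != b, size t == 2, uniq t, all (gtn 12) t,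
      all (fun c => (a \in thirds s b c) && (c \in thirds s b a)) t,
      uniq (walk s a b b 6) & size (walk s a b b 6) == 7].

Definition complete (s : links) : bool :=
  all (fun a => (count (fun b => thirds s a b != [::]) (iota 0 12) == 7) &&
                all (complete_at s a) (iota 0 12)) (iota 0 12).

Lemma card_ord_mem (n : nat) (t : seq nat) : uniq t -> all (gtn n) t ->
  #|[set i : 'I_n | (i : nat) \in t]| = size t.
Proof.
move=> ut /allP tn; rewrite cardE -(size_map val); apply/perm_size/uniq_perm => //.
  by rewrite map_inj_uniq ?enum_uniq //; apply: val_inj.
move=> x; apply/mapP/idP => [[i]|xt]; first by rewrite mem_enum inE => it ->.
by exists (Ordinal (tn x xt)); rewrite // mem_enum inE.
Qed.

Lemma walk_closed (P : pred nat) (s : links) (a prev x n : nat) :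
  (forall y z, P y -> z \in thirds s a y -> P z) -> P x -> all P (walk s a prev x n).
Proof.
move=> clP; elim: n prev x => [|n IHn] prev x Px /=; rewrite Px //=.
case E: (thirds s a x) => [|y [|z []]] //; apply: IHn.
by case: ifP => _; apply: (clP x); rewrite // E !inE eqxx ?orbT.
Qed.

Section Complete.

Variable s : links.
Hypothesis s_complete : complete s.

Lemma completeP a b : a < 12 -> b < 12 -> complete_at s a b.
Proof.
move=> a12 b12; have /allP/(_ a) := s_complete.
by rewrite mem_iota a12 => /(_ isT)/andP[_ /allP/(_ b)]; rewrite mem_iota b12; apply.
Qed.

Lemma complete_thirds a b c : a < 12 -> b < 12 -> c \in thirds s a b ->
  [/\ a != b, size (thirds s a b) = 2, uniq (thirds s a b) & all (gtn 12) (thirds s a b)].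
Proof.
move=> a12 b12; have := completeP a12 b12; rewrite /complete_at.
by case/orP => [/eqP-> //|/and5P[ab /eqP st ut t12 _]].
Qed.

Lemma tri_of_uniq_two (a b c : 'I_12) : tri_of s a b c -> #|[set x | tri_of s a b x]| = 2.
Proof. by case/complete_thirds => // _ s2 us s12; rewrite card_ord_mem. Qed.

Lemma complete_triangulation : triangulation 7 (tri_of s).
Proof.
have comp (a b c : 'I_12) : tri_of s a b c ->
    [/\ tri_of s b c a, tri_of s b a c, uniq (walk s a b b 6)
      & size (walk s a b b 6) = 7].
  rewrite /tri_of => abc; have := completeP (ltn_ord a) (ltn_ord b).
  rewrite /complete_at; case/orP => [/eqP E|]; first by rewrite E in abc.
  case/and5P => _ _ _ _ /and3P[/allP/(_ c abc)/andP[bca bac] uw /eqP sw].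
  by rewrite bca bac.
split.
- by move=> a b c /comp[].
- by move=> a b c /comp[].
- by move=> a b c /complete_thirds[].
- exact: tri_of_uniq_two.
- move=> a; pose t := [seq b <- iota 0 12 | thirds s a b != [::]].
  have size_t : size t = 7.
    have /allP/(_ (a : nat)) := s_complete; rewrite mem_iota ltn_ord size_filter.
    by move=> /(_ isT)/andP[/eqP-> _].
  rewrite -[RHS]size_t -(card_ord_mem (n := 12)); last 2 first.
  - by rewrite filter_uniq ?iota_uniq.
  - by apply/allP => x; rewrite mem_filter mem_iota => /andP[].
  apply: eq_card => b; rewrite !inE mem_filter mem_iota ltn_ord andbT.
  apply/existsP/idP => [[c]|]; first by rewrite /tri_of; case: (thirds s a b).
  case E: (thirds s a b) => [|c t'] // _.
  have ct : c \in thirds s a b by rewrite E mem_head.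
  have [_ _ _ /allP/(_ c ct) c12] := complete_thirds (ltn_ord a) (ltn_ord b) ct.
  by exists (Ordinal c12).
- move=> a S [b [c [bS abc]]] clS; have [_ _ uw sw] := comp a b c abc.
  pose P y := [exists i in S, y == i :> nat].
  have /allP walkP : all P (walk s a b b 6).
    apply: walk_closed => [x z /exists_inP[i iS /eqP->] az|].
      have [_ _ _ /allP/(_ z az) z12] := complete_thirds (ltn_ord a) (ltn_ord i) az.
      by apply/exists_inP; exists (Ordinal z12) => //; apply: (clS i).
    by apply/exists_inP; exists b.
  rewrite -[leqLHS]sw cardE -(size_map val); apply: uniq_leq_size => // y /walkP.
  by case/exists_inP => i iS /eqP->; rewrite map_f ?mem_enum.
Qed.

End Complete.

(** * Maps realizing a complete triangulation *)

(** A vertex and its image have the same number of neighbours, and so do an edge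
    and its image have the same number of triangles, so no triangle on the image
    of a vertex is missed. *)
Lemma triangulation_morphism (d : nat) (V W : finType) (S : W -> W -> W -> bool)
    (T : V -> V -> V -> bool) (phi : W -> V) :
  triangulation d S -> triangulation d T -> injective phi ->
  (forall a b c, S a b c -> T (phi a) (phi b) (phi c)) ->
  forall a b c, T (phi a) (phi b) (phi c) = S a b c.
Proof.
move=> triS triT inj_phi morph a b c; apply/idP/idP => [abc|]; last exact: morph.
have image_eq (A : {set W}) (B : {set V}) : #|A| = #|B| ->
    (forall x, x \in A -> phi x \in B) -> forall x, (phi x \in B) = (x \in A).
  move=> AB sub x; have <- : [set phi y | y in A] = B; last by rewrite mem_imset.
  apply/eqP; rewrite eqEcard card_imset // AB leqnn andbT.
  by apply/subsetP => _ /imsetP[y yA ->]; apply: sub.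
have [c' abc'] : exists c', S a b c'.
  suff : b \in [set x | [exists y, S a x y]] by rewrite inE => /existsP.
  rewrite -(image_eq _ [set x | [exists y, T (phi a) x y]]).
  - by rewrite inE; apply/existsP; exists (phi c).
  - by rewrite (tri_degree triS) (tri_degree triT).
  - move=> x; rewrite !inE => /existsP[y /morph axy].
    by apply/existsP; exists (phi y).
have : c \in [set x | S a b x]; last by rewrite inE.
rewrite -(image_eq _ [set x | T (phi a) (phi b) x]); first by rewrite inE.
  by rewrite (tri_two triS abc') (tri_two triT abc).
by move=> x; rewrite !inE; apply: morph.
Qed.

Lemma realizes_complete (V : finType) (T : V -> V -> V -> bool) (x0 : V)
    (e : seq V) (s : links) :
  triangulation 7 T -> #|V| = 12 -> complete s -> realizes T x0 e s ->
  exists2 phi : 'I_12 -> V, bijective phi &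
    forall a b c, T (phi a) (phi b) (phi c) = tri_of s a b c.
Proof.
move=> triT V12 s_complete [ue us sT]; have triS := complete_triangulation s_complete.
have size_e : size e = 12.
  apply/eqP; rewrite eqn_leq -{1}V12 -(card_uniqP ue) max_card /=.
  have : 0 < #|[set b : 'I_12 | [exists c, tri_of s ord_max b c]]|.
    by rewrite (tri_degree triS).
  case/card_gt0P => b; rewrite inE => /existsP[c /sT[]].
  by rewrite -(card_uniqP ue).
pose phi (i : 'I_12) := nth x0 e i.
have inj_phi : injective phi.
  move=> i j /eqP; rewrite /phi nth_uniq ?size_e //.
  by move/eqP/val_inj.
exists phi; first by apply: inj_card_bij => //; rewrite card_ord V12.
by apply: (triangulation_morphism triS triT) => // a b c /sT[].
Qed.

(** * Completeness of pattern matching *)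

(** An embedding [f] of the links of [q] sends the third vertex [k] of an edge to
    the third vertex of the image edge, so following [p] from the images of its
    first vertices reproduces [f] at every step. *)
Lemma embeds_complete (s : links) (p q : pattern) (f : nat -> nat) (n : nat) :
  complete s -> complete (links_of q) -> n <= 12 ->
  (forall a, f a < 12) -> {in gtn 12 &, injective f} ->
  (forall a b c, a < 12 -> b < 12 -> c \in thirds (links_of q) a b ->
     f c \in thirds s (f a) (f b)) ->
  follows (links_of q) n p -> embeds_at s p [seq f i | i <- iota 0 n].
Proof.
move=> sC qC n12 f12 inj_f morph; elim: p n n12 => [|[[[a b] c] k] p IHp] n n12 //=.
case/andP => /andP[/and4P[an bn cn kn] /and3P[abc abk kc]] fp.
have lt12 x : x < n -> x < 12 by move/leq_trans; apply.
have a12 := lt12 a an; have b12 := lt12 b bn; have c12 := lt12 c cn.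
have [_ _ _ /allP/(_ k abk) k12] := complete_thirds qC a12 b12 abk.
have nth_f x : x < n -> nth 0 [seq f i | i <- iota 0 n] x = f x.
  by move=> xn; rewrite (nth_map 0) ?size_iota // nth_iota.
rewrite !nth_f //.
have fabc := morph _ _ _ a12 b12 abc; have fabk := morph _ _ _ a12 b12 abk.
have fkc : f k != f c by rewrite (inj_in_eq inj_f).
have -> : [seq x <- thirds s (f a) (f b) | ~~ eqn x (f c)] = [:: f k].
  have [_ s2 us _] := complete_thirds sC (f12 a) (f12 b) fabc.
  move: s2 us fabc fabk; case: (thirds s _ _) => [|x [|y []]] //= _.
  have eqnE u v : eqn u v = (u == v) by [].
  rewrite !inE andbT !eqnE => xy /orP[] /eqP Ec /orP[] /eqP Ek; rewrite Ec Ek.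
  - by rewrite Ec Ek eqxx in fkc.
  - by rewrite eqxx eq_sym xy.
  - by rewrite eqxx xy.
  - by rewrite Ec Ek eqxx in fkc.
pose fs := [seq f i | i <- iota 0 n].
have ufs : uniq fs.
  rewrite map_inj_in_uniq ?iota_uniq // => x y; rewrite !mem_iota /= => xn yn.
  by apply: inj_f; apply: lt12.
have k_or : k = n \/ k < n by move: kn; rewrite leq_eqVlt => /orP[/eqP|]; [left|right].
have find_f : find (eqn (f k)) fs = k.
  rewrite find_eqn; case: k_or => [Ek|kn'].
    rewrite memNindex ?size_map ?size_iota //.
    apply/mapP => -[x]; rewrite mem_iota /= => xn /inj_f.
    by move=> /(_ k12 (lt12 x xn)) kx; rewrite -kx Ek ltnn in xn.
  by rewrite -(nth_f k kn') index_uniq // size_map size_iota.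
rewrite find_f size_map size_iota.
have -> : eqn k k by apply/eqnP.
case: k_or => [Ek|kn'].
  have -> : eqn k n by apply/eqnP.
  rewrite Ek -map_rcons -cats1 -[[:: n]]/(iota (0 + n) 1) -iotaD addn1.
  by apply: IHp; rewrite -?Ek // ?(maxn_idPr _) // in fp *.
have -> : eqn k n = false by apply: ltn_eqF.
by apply: IHp => //; move: fp; rewrite (maxn_idPl _).
Qed.

(** * Deciding orientability *)

(** The two triangles on an edge must traverse it in opposite directions, so the
    orientation of [abc] forces that of [abk]. *)
Definition orient_flip (o : links) (i : nat * nat * nat * nat) : links :=
  let: (a, b, c, k) := i in
  if c \in thirds o a b then add_oriented o b a k
  else if c \in thirds o b a then add_oriented o a b k
  else o.

Definition orient (p : pattern) : links :=
  foldl orient_flip (add_oriented [::] 0 1 2) p.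

Definition oriented (s o : links) : bool :=
  all (fun a => all (fun b => all (fun c =>
    let oabc := c \in thirds o a b in
    [&& (a \in thirds o b c) == oabc, (c \in thirds o b a) == ~~ oabc
      & all (fun x => (x == c) || ((x \in thirds o a b) == ~~ oabc)) (thirds s a b)])
    (thirds s a b)) (iota 0 12)) (iota 0 12).

(** Two different triangles traverse the edge [ab] in the same direction. *)
Definition conflicting (o : links) : bool :=
  has (fun a => has (fun b =>
    has (fun c => has (predC1 c) (thirds o a b)) (thirds o a b)) (iota 0 12)) (iota 0 12).

Lemma orientedP (s o : links) : oriented s o -> orientation (tri_of s) (tri_of o).
Proof.
move=> /allP ok a b c abc; have := ok a; rewrite mem_iota ltn_ord => /(_ isT)/allP/(_ b).
rewrite mem_iota ltn_ord => /(_ isT)/allP/(_ c abc)/and3P[/eqP bca /eqP bac /allP opp].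
split=> // x abx xc; have := opp x abx.
by rewrite -val_eqE in xc; rewrite (negPf xc) => /eqP.
Qed.

Lemma orientation_neg (V : finType) (T o : V -> V -> V -> bool) :
  orientation T o -> orientation T (fun a b c => ~~ o a b c).
Proof.
move=> oP a b c /oP[-> -> opp]; split=> // x abx xc.
by rewrite opp.
Qed.

Lemma follows_incident (s : links) (n : nat) (p : pattern) :
  complete s -> n <= 12 -> follows s n p ->
  all (fun i : nat * nat * nat * nat => let: (a, b, c, k) := i in
    [&& a < 12, b < 12, c \in thirds s a b, k \in thirds s a b & k != c]) p.
Proof.
move=> sC; elim: p n => [|[[[a b] c] k] p IHp] n n12 //=.
case/andP => /andP[/and4P[an bn cn kn] /and3P[abc abk kc]] fp.
have a12 := leq_trans an n12; have b12 := leq_trans bn n12.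
rewrite a12 b12 abc abk kc; apply: IHp fp; rewrite geq_max n12.
by have [_ _ _ /allP/(_ k abk)] := complete_thirds sC a12 b12 abk.
Qed.

(** Up to reversal an orientation agrees with [orient p] on the first triangle,
    hence on all triangles that [orient] reaches, and a conflict refutes it. *)
Lemma conflicting_nonorientable (p : pattern) (o : 'I_12 -> 'I_12 -> 'I_12 -> bool) :
  complete (links_of p) -> well_formed p -> 2 \in thirds (links_of p) 0 1 ->
  conflicting (orient p) -> ~ orientation (tri_of (links_of p)) o.
Proof.
move=> sC wf t012; set s := links_of p in sC wf t012 *.
have wf12 := follows_incident sC (isT : 3 <= 12) wf.
move=> conf oP0.
have [o' oP o012] : exists2 o', orientation (tri_of s) o' & o' (inord 0) (inord 1) (inord 2).
  case o012 : (o (inord 0) (inord 1) (inord 2)); first by exists o.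
  by exists (fun a b c => ~~ o a b c); [apply: orientation_neg|rewrite o012].
pose S a b c := [&& a < 12, b < 12 & c \in thirds s a b].
pose O a b c := o' (inord a) (inord b) (inord c).
have SO a b c : S a b c -> [/\ S b c a, S b a c, O b c a = O a b c, O b a c = ~~ O a b c
    & forall x, x \in thirds s a b -> x != c -> O a b x = ~~ O a b c].
  case/and3P => a12 b12 abc.
  have [_ _ _ /allP ltn12] := complete_thirds sC a12 b12 abc.
  have c12 : c < 12 := ltn12 c abc.
  have abc' : tri_of s (inord a) (inord b) (inord c) by rewrite /tri_of !inordK.
  have [bca bac opp] := oP _ _ _ abc'.
  have triS := complete_triangulation sC.
  have := tri_rot triS abc'; have := tri_swap triS abc'.
  rewrite /tri_of !inordK // => bac' bca'.
  split=> //; rewrite /S ?a12 ?b12 ?c12 // => x abx xc.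
  have x12 : x < 12 := ltn12 x abx; apply: opp; first by rewrite /tri_of !inordK.
  by rewrite -val_eqE /= !inordK.
pose valid (q : links) := forall a b c, c \in thirds q a b -> S a b c && O a b c.
have valid_add q a b c : S a b c -> O a b c -> valid q -> valid (add_oriented q a b c).
  move=> Sabc Oabc vq x y z; rewrite !mem_add_third => /orP[/orP[/orP[/vq //|]|]|].
  - by case/and3P => /eqP-> /eqP-> /eqP->; rewrite Sabc.
  - by have [Sbca _ Obca _ _] := SO _ _ _ Sabc;
      case/and3P => /eqP-> /eqP-> /eqP->; rewrite Sbca Obca.
  - have [Sbca _ Obca _ _] := SO _ _ _ Sabc; have [Scab _ Ocab _ _] := SO _ _ _ Sbca.
    by case/and3P => /eqP-> /eqP-> /eqP->; rewrite Scab Ocab Obca.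
have : valid (orient p).
  have : valid (add_oriented [::] 0 1 2).
    by apply: valid_add => // a b c; rewrite thirds0.
  rewrite /orient; elim: (p) (add_oriented _ _ _ _) wf12 => [|[[[a b] c] k] p' IHp] q //=.
  case/andP => /and5P[a12 b12 abc abk kc] wfp' vq; apply: IHp => //.
  have Sabk : S a b k by rewrite /S a12 b12.
  have Sabc : S a b c by rewrite /S a12 b12.
  have [_ Sbac _ Obac opp] := SO _ _ _ Sabc; have [_ Sbak _ Obak _] := SO _ _ _ Sabk.
  rewrite /orient_flip; case: ifP => [/vq/andP[_ Oabc]|_].
    by apply: valid_add; rewrite // Obak opp ?Oabc.
  case: ifP => // /vq/andP[_]; rewrite Obac => nOabc.
  by apply: valid_add; rewrite // opp.
case/hasP: conf => a _ /hasP[b _ /hasP[c oc /hasP[x ox xc]]] v.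
have /andP[Sabc Oabc] := v _ _ _ oc; have /andP[Sabx Oabx] := v _ _ _ ox.
have [_ _ _ _ /(_ x)] := SO _ _ _ Sabc; have /and3P[_ _ abx] := Sabx.
by rewrite Oabx Oabc => /(_ abx xc).
Qed.

(** * Classification from a list of patterns *)

Definition triangular_map (M : cell_complex) : Prop :=
  [/\ on_nonorientable_surface 4 M, equivelar_type_n 3 7 12 M & polyhedral M].

Definition heptagonal_map (M : cell_complex) : Prop :=
  [/\ on_nonorientable_surface 4 M, equivelar_type_n 7 3 28 M & polyhedral M].

Definition model (p : pattern) : cell_complex := complex_of (tri_of (links_of p)).

Definition sound_pattern (p : pattern) : bool :=
  [&& well_formed p, complete (links_of p) & 2 \in thirds (links_of p) 0 1].

Definition nonorientable_pattern (p : pattern) : bool :=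
  sound_pattern p && conflicting (orient p).

Definition orientable_pattern (p : pattern) : bool :=
  sound_pattern p && oriented (links_of p) (orient p).

Lemma model_triangular p : nonorientable_pattern p -> triangular_map (model p).
Proof.
case/andP => /and3P[wf sC t012] conf; have triS := complete_triangulation sC.
have V_small : 0 < #|'I_12| < (7.+1).*2 by rewrite card_ord.
have surf : is_surface_map (model p) by apply: (complex_surface triS).
have type37 : equivelar_type 3 7 (model p) by apply: (complex_type triS).
have poly : polyhedral (model p) by apply: (complex_polyhedral triS).
have card12 : #|vertex (model p)| = 12 by rewrite card_ord.
split=> //; split=> //; last first.
  have := equivelar_counts surf type37; rewrite card12 /euler_char card12 -!muln2.
  by case; lia.
case/(orientable_orientation surf poly type37) => o oP.
apply: (conflicting_nonorientable sC wf t012 conf (o := o)).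
by move=> a b c; rewrite -!(tri_complex triS) => /oP[bca bac opp]; split=> // x;
  rewrite -(tri_complex triS); apply: opp.
Qed.

(** The orientation found for the pattern is carried back to [M] along the
    bijection of the vertices. *)
Lemma realizable_isomorphic (M : cell_complex) (x0 : vertex M) (p : pattern) :
  is_surface_map M -> polyhedral M -> equivelar_type 3 7 M -> #|vertex M| = 12 ->
  sound_pattern p -> realizable (@tri M) x0 p ->
  isomorphic M (model p) /\ (oriented (links_of p) (orient p) -> orientable M).
Proof.
move=> surfM polyM typeM card12 /and3P[_ sC _] [e _ es].
have triM := map_triangulation surfM polyM typeM.
have [phi bij_phi phiT] := realizes_complete triM card12 sC es.
split=> [|/orientedP ori]; first exact: isomorphic_complex_of surfM polyM typeM bij_phi phiT.
have [psi phiK psiK] := bij_phi.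
apply: (orientation_orientable surfM polyM typeM
  (o := fun a b c => tri_of (orient p) (psi a) (psi b) (psi c))) => a b c.
rewrite -[a]psiK -[b]psiK -[c]psiK phiT !phiK => /ori[bca bac opp]; split=> // x.
rewrite -[x]psiK phiT !phiK => abx xc; apply: opp => //.
by apply: contraNneq xc => ->.
Qed.

(** The triangle 012 of [p] goes to some triangle of [q], so a matching that fails
    from all of them refutes an isomorphism. *)
Lemma isomorphic_occurs p q : sound_pattern p -> sound_pattern q ->
  isomorphic (model p) (model q) -> occurs [:: p] (links_of q).
Proof.
case/and3P => wf pC t012 /and3P[_ qC _] /isomorphic_tri[phi /bij_inj inj_phi morph].
have triP := complete_triangulation pC; have triQ := complete_triangulation qC.
pose f (i : nat) : nat := phi (inord i : 'I_12) : 'I_12.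
have f12 i : f i < 12 by apply: ltn_ord.
have inj_f : {in gtn 12 &, injective f}.
  move=> i j i12 j12 /val_inj/inj_phi/(congr1 val)/=.
  by rewrite !inordK.
have f_morph a b c : a < 12 -> b < 12 -> c \in thirds (links_of p) a b ->
    f c \in thirds (links_of q) (f a) (f b).
  move=> a12 b12 abc; have [_ _ _ /allP/(_ c abc) c12] := complete_thirds pC a12 b12 abc.
  have := morph (inord a) (inord b) (inord c).
  rewrite (tri_complex triP) (tri_complex triQ); apply.
  by rewrite /tri_of !inordK.
apply/hasP; exists [seq f i | i <- iota 0 3].
  by apply/flagsP; exists (f 0), (f 1), (f 2); split=> //; apply: f_morph.
by rewrite /= orbF; apply: (@embeds_complete _ p p f 3).
Qed.

Section Classification.

Variables (early late : pattern) (ns os : seq pattern).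
Hypotheses (early_wf : well_formed early) (late_wf : well_formed late).
Hypotheses (ns_ok : all nonorientable_pattern ns) (os_ok : all orientable_pattern os).
Hypothesis explored_start : explored (occurs [:: early; late]) pred0 [::].
Hypothesis explored_early :
  explored pred0 (occurs_beyond early (ns ++ os)) early.
Hypothesis explored_late : explored (occurs [:: early]) (occurs (ns ++ os)) late.
Hypothesis ns_distinct : pairwise (fun p q => ~~ occurs [:: p] (links_of q)) ns.

Lemma sound_patterns p : p \in ns ++ os -> sound_pattern p.
Proof.
by rewrite mem_cat => /orP[/(allP ns_ok)|/(allP os_ok)] /andP[].
Qed.

(** Exploring from [late] may stop at [early], since the triangulations that
    contain [early] are covered by exploring from it. *)
Lemma triangulation_realizes_pattern (V : finType) (T : V -> V -> V -> bool) (x0 : V) :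
  triangulation 7 T -> #|V| = 12 ->
  exists2 p, p \in ns ++ os & realizable T x0 p.
Proof.
move=> triT V12; have V12' : #|V| <= 12 by rewrite V12.
have wf_all : all well_formed (ns ++ os).
  by apply/allP => p /sound_patterns/and3P[].
have early_case : realizable T x0 early ->
    exists2 p, p \in ns ++ os & realizable T x0 p.
  apply: (explored_sound triT V12' _ _ explored_early) => // e s es.
  exact: (occurs_realizable triT wf_all es).
have late_case : realizable T x0 late ->
    exists2 p, p \in ns ++ os & realizable T x0 p.
  apply: (explored_sound triT V12' _ _ explored_late) => e s es occ.
    have [|p] := occurs_realizable (p0 := [::]) triT _ es occ; first by rewrite all_seq1.
    by rewrite mem_seq1 => /eqP->.
  exact: (occurs_realizable (p0 := [::]) triT wf_all es occ).
have [y [z xyz]] : exists y z, T x0 y z.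
  have : 0 < #|[set b | [exists c, T x0 b c]]| by rewrite (tri_degree triT).
  by case/card_gt0P => y; rewrite inE => /existsP[z xyz]; exists y, z.
apply: (explored_sound triT V12' _ _ explored_start (realizable_nil x0 triT xyz))
  => // e s es occ.
have [|p] := occurs_realizable (p0 := [::]) triT _ es occ.
  by rewrite /= early_wf late_wf.
by rewrite !inE => /orP[] /eqP->.
Qed.

Lemma triangular_maps_classified : exactly_up_to_iso (size ns) triangular_map.
Proof.
exists (fun i => model (nth [::] ns i)).
have nsP i : i < size ns -> nonorientable_pattern (nth [::] ns i).
  by move=> im; apply: (allP ns_ok); apply: mem_nth.
have distinct i j : i < j < size ns ->
    ~ isomorphic (model (nth [::] ns i)) (model (nth [::] ns j)).
  case/andP => ij jn; have im := ltn_trans ij jn.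
  have /andP[pS _] := nsP i im; have /andP[qS _] := nsP j jn.
  move/(isomorphic_occurs pS qS); apply/negP.
  by have /(pairwiseP [::]) := ns_distinct; apply.
split=> [i|i j iso|M].
- exact/model_triangular/nsP.
- apply/val_inj/eqP; case: ltngtP => // ij.
    by case: (distinct i j _ iso); rewrite ij ltn_ord.
  by case: (distinct j i _ (isomorphic_sym iso)); rewrite ij ltn_ord.
case=> [[surfM norM _] [typeM card12] polyM].
have triM := map_triangulation surfM polyM typeM.
have /card_gt0P[x0 _] : 0 < #|vertex M| by rewrite card12.
have [p pA real_p] := triangulation_realizes_pattern x0 triM card12.
have [iso ori] := realizable_isomorphic surfM polyM typeM card12 (sound_patterns pA) real_p.
move: pA; rewrite mem_cat => /orP[pN|/(allP os_ok)/andP[_ /ori]//].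
by have pi := pN; rewrite -index_mem in pi; exists (Ordinal pi); rewrite /= nth_index.
Qed.

End Classification.

(** * Dual maps and the full count *)

Lemma exactly_ext (n : nat) (P Q : cell_complex -> Prop) :
  (forall M, P M <-> Q M) -> exactly_up_to_iso n P -> exactly_up_to_iso n Q.
Proof.
move=> PQ [s [sP s_inj s_all]]; exists s; split=> // [i|M /PQ]; last exact: s_all.
exact/PQ.
Qed.

Lemma exactly_dual (n : nat) (P Q : cell_complex -> Prop) :
  (forall M, P M -> Q (dual M)) -> (forall M, Q M -> P (dual M)) ->
  exactly_up_to_iso n P -> exactly_up_to_iso n Q.
Proof.
move=> PQ QP [s [sP s_inj s_all]]; exists (fun i => dual (s i)); split.
- by move=> i; apply: PQ.
- by move=> i j /dual_isomorphic; rewrite !dualK; apply: s_inj.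
- move=> M /QP/s_all[i /dual_isomorphic]; rewrite dualK => iso.
  by exists i.
Qed.

Lemma exactly_union (m n : nat) (P Q : cell_complex -> Prop) :
  (forall M N, P M -> Q N -> ~ isomorphic M N) ->
  exactly_up_to_iso m P -> exactly_up_to_iso n Q ->
  exactly_up_to_iso (m + n) (fun M => P M \/ Q M).
Proof.
move=> disj [s [sP s_inj s_all]] [t [tQ t_inj t_all]].
exists (fun i => match split i with inl j => s j | inr j => t j end); split.
- by move=> i; case: split => j; [left|right].
- move=> i j iso; rewrite -[i]splitK -[j]splitK; move: iso.
  case: (split i) => i'; case: (split j) => j' iso.
  + by rewrite (s_inj _ _ iso).
  + by case: (disj _ _ (sP i') (tQ j')).
  + by case: (disj _ _ (sP j') (tQ i')); apply: isomorphic_sym.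
  + by rewrite (t_inj _ _ iso).
move=> M [/s_all[i iso]|/t_all[i iso]].
  by exists (unsplit (inl i)); rewrite unsplitK.
by exists (unsplit (inr i)); rewrite unsplitK.
Qed.

Lemma dual_triangular M : triangular_map M -> heptagonal_map (dual M).
Proof.
move=> [onM [typeM card12] polyM]; have [surfM _ _] := onM.
have [nq fp] := equivelar_counts surfM typeM.
have [_ _ Hp Hq] := typeM.
split; first exact: dual_nonorientable_surface.
  split; first by split.
  by move: nq fp; rewrite card12 /=; lia.
by apply: dual_polyhedral => // f; rewrite Hp.
Qed.

Lemma dual_heptagonal M : heptagonal_map M -> triangular_map (dual M).
Proof.
move=> [onM [typeM card28] polyM]; have [surfM _ _] := onM.
have [nq fp] := equivelar_counts surfM typeM.
have [_ _ Hp Hq] := typeM.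
split; first exact: dual_nonorientable_surface.
  split; first by split.
  by move: nq fp; rewrite card28 /=; lia.
by apply: dual_polyhedral => // f; rewrite Hp.
Qed.

Lemma equivelar_polyhedral_cases (M : cell_complex) :
  triangular_map M \/ heptagonal_map M <->
  [/\ on_nonorientable_surface 4 M, equivelar M & polyhedral M].
Proof.
split=> [[]|[onM [p [q typeM]] polyM]].
- by case=> onM [typeM _] polyM; split=> //; exists 3, 7.
- by case=> onM [typeM _] polyM; split=> //; exists 7, 3.
have [surfM _ eulerM] := onM.
have [[Ep Eq En]|[Ep Eq En]] := equivelar_polyhedral_types surfM polyM eulerM typeM.
  by rewrite Ep Eq in typeM; left.
by rewrite Ep Eq in typeM; right.
Qed.

Lemma triangular_heptagonal_disjoint M N :
  triangular_map M -> heptagonal_map N -> ~ isomorphic M N.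
Proof.
move=> [_ [_ cardM] _] [_ [_ cardN] _] [phi [_ [_ [/bij_eq_card cardMN _ _ _ _]]]].
by rewrite cardM cardN in cardMN.
Qed.

(** * The patterns *)

(** Codes of one complete triangulation from each isomorphism class, as found by
    the search.  All of them start with the star of the vertex 0, whose link is
    the circuit 1, ..., 7: the entries 3, 4, 5, 6, 7, 1.  The next entry is the
    third vertex, other than 0, on the edge 17. *)
Definition nonorientable_codes : seq (seq nat) := [::
  [:: 3; 4; 5; 6; 7; 1; 3; 2; 6; 8; 1; 5; 9; 4; 10; 2; 9; 11; 2; 4; 8; 5; 5; 8; 4; 10; 10];
  [:: 3; 4; 5; 6; 7; 1; 3; 2; 8; 6; 1; 5; 9; 1; 10; 2; 11; 2; 4; 4; 5; 8; 10; 8; 5; 8; 9];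
  [:: 3; 4; 5; 6; 7; 1; 3; 2; 8; 6; 1; 5; 9; 1; 10; 2; 11; 2; 4; 4; 8; 5; 11; 8; 8; 5; 9];
  [:: 3; 4; 5; 6; 7; 1; 3; 2; 8; 6; 1; 5; 9; 1; 10; 2; 11; 2; 5; 5; 4; 8; 10; 8; 4; 8; 9];
  [:: 3; 4; 5; 6; 7; 1; 3; 2; 8; 6; 1; 5; 9; 1; 10; 2; 11; 2; 5; 5; 8; 4; 11; 8; 8; 4; 9];
  [:: 3; 4; 5; 6; 7; 1; 3; 2; 8; 6; 1; 7; 9; 1; 10; 2; 11; 2; 5; 5; 9; 4; 11; 8; 8; 4; 9];
  [:: 3; 4; 5; 6; 7; 1; 3; 2; 8; 9; 1; 6; 5; 2; 8; 10; 5; 11; 4; 11; 6; 9; 4; 6; 9; 4; 9];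
  [:: 3; 4; 5; 6; 7; 1; 3; 4; 6; 8; 1; 9; 7; 2; 10; 4; 10; 11; 2; 9; 5; 8; 5; 5; 4; 4; 8];
  [:: 3; 4; 5; 6; 7; 1; 3; 4; 8; 9; 1; 4; 5; 2; 10; 7; 11; 6; 10; 11; 5; 8; 6; 9; 6; 6; 9];
  [:: 3; 4; 5; 6; 7; 1; 3; 4; 8; 9; 1; 5; 10; 2; 4; 11; 6; 9; 2; 8; 8; 6; 4; 4; 7; 7; 8];
  [:: 3; 4; 5; 6; 7; 1; 3; 4; 8; 9; 1; 5; 10; 2; 11; 4; 6; 6; 11; 6; 9; 7; 8; 7; 4; 4; 9];
  [:: 3; 4; 5; 6; 7; 1; 3; 4; 8; 9; 1; 10; 4; 2; 7; 2; 11; 5; 11; 6; 8; 6; 6; 9; 5; 5; 9];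
  [:: 3; 4; 5; 6; 7; 1; 3; 4; 8; 9; 1; 10; 5; 2; 8; 4; 2; 11; 6; 10; 4; 11; 7; 7; 6; 6; 9];
  [:: 3; 4; 5; 6; 7; 1; 3; 4; 8; 9; 1; 10; 5; 2; 11; 4; 2; 10; 6; 8; 6; 11; 7; 4; 4; 7; 8];
  [:: 3; 4; 5; 6; 7; 1; 3; 4; 8; 9; 1; 10; 5; 2; 11; 4; 2; 11; 6; 8; 9; 4; 6; 7; 4; 7; 8];
  [:: 3; 4; 5; 6; 7; 1; 3; 4; 8; 9; 1; 10; 6; 2; 5; 11; 2; 5; 5; 10; 4; 9; 4; 8; 4; 8; 10];
  [:: 3; 4; 5; 6; 7; 1; 3; 4; 8; 9; 1; 10; 11; 2; 9; 5; 5; 8; 5; 6; 4; 6; 4; 7; 4; 7; 10];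
  [:: 3; 4; 5; 6; 7; 1; 3; 8; 2; 9; 1; 5; 10; 2; 4; 11; 6; 11; 9; 8; 4; 6; 6; 8; 7; 7; 10];
  [:: 3; 4; 5; 6; 7; 1; 3; 8; 2; 9; 1; 6; 10; 2; 5; 11; 7; 5; 5; 4; 8; 4; 2; 8; 9; 8; 9];
  [:: 3; 4; 5; 6; 7; 1; 3; 8; 2; 9; 1; 6; 10; 2; 5; 11; 7; 5; 5; 4; 8; 11; 4; 4; 8; 2; 9];
  [:: 3; 4; 5; 6; 7; 1; 3; 8; 2; 9; 1; 6; 10; 2; 7; 11; 5; 5; 5; 8; 4; 11; 2; 2; 8; 4; 8];
  [:: 3; 4; 5; 6; 7; 1; 3; 8; 2; 9; 1; 6; 10; 2; 11; 7; 5; 4; 4; 5; 8; 10; 5; 8; 2; 2; 5];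
  [:: 3; 4; 5; 6; 7; 1; 3; 8; 2; 9; 1; 6; 10; 2; 11; 7; 5; 5; 5; 4; 8; 10; 4; 8; 2; 2; 4];
  [:: 3; 4; 5; 6; 7; 1; 3; 8; 2; 9; 1; 10; 11; 2; 5; 10; 5; 4; 9; 6; 8; 4; 6; 4; 7; 6; 10];
  [:: 3; 4; 5; 6; 7; 1; 3; 8; 2; 9; 1; 10; 11; 2; 6; 10; 6; 7; 9; 5; 5; 5; 4; 8; 4; 4; 10];
  [:: 3; 4; 5; 6; 7; 1; 3; 8; 9; 2; 1; 10; 11; 2; 5; 10; 5; 8; 6; 4; 9; 4; 6; 7; 6; 7; 9];
  [:: 3; 4; 5; 6; 7; 1; 3; 8; 9; 2; 1; 10; 11; 2; 6; 5; 5; 8; 11; 5; 5; 9; 6; 7; 6; 7; 9];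
  [:: 3; 4; 5; 6; 7; 1; 4; 8; 3; 9; 1; 10; 11; 2; 10; 11; 6; 3; 2; 2; 5; 5; 9; 6; 3; 6; 9]].

Definition orientable_codes : seq (seq nat) := [::
  [:: 3; 4; 5; 6; 7; 1; 3; 4; 8; 9; 1; 5; 10; 2; 4; 11; 6; 6; 11; 6; 8; 7; 7; 4; 9; 4; 9];
  [:: 3; 4; 5; 6; 7; 1; 3; 4; 8; 9; 1; 5; 10; 2; 8; 6; 4; 11; 2; 4; 6; 6; 9; 7; 4; 7; 10];
  [:: 3; 4; 5; 6; 7; 1; 3; 4; 8; 9; 1; 6; 10; 2; 8; 7; 5; 11; 4; 11; 2; 5; 5; 5; 4; 2; 4];
  [:: 3; 4; 5; 6; 7; 1; 3; 4; 8; 9; 1; 6; 10; 2; 11; 5; 7; 11; 4; 10; 8; 5; 2; 8; 2; 4; 8];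
  [:: 3; 4; 5; 6; 7; 1; 3; 4; 8; 9; 1; 10; 4; 2; 5; 2; 11; 7; 6; 8; 5; 9; 6; 10; 6; 6; 10];
  [:: 3; 4; 5; 6; 7; 1; 3; 4; 8; 9; 1; 10; 4; 2; 5; 2; 11; 7; 6; 11; 8; 6; 6; 9; 5; 5; 9]].

(** The star of 0 with the triangle 137, or with the triangle 147.  The first
    pattern occurs in all classes but one, and exploring from it reaches each
    class from far fewer starting positions than exploring from one triangle. *)
Definition early_pattern : pattern :=
  Eval vm_compute in decode [:: 3; 4; 5; 6; 7; 1; 3].

Definition late_pattern : pattern :=
  Eval vm_compute in decode [:: 3; 4; 5; 6; 7; 1; 4].

(** Decoded once, rather than at every use in the computations below. *)
Definition nonorientable_patterns : seq pattern :=
  Eval vm_compute in [seq decode c | c <- nonorientable_codes].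

Definition orientable_patterns : seq pattern :=
  Eval vm_compute in [seq decode c | c <- orientable_codes].

Lemma early_pattern_well_formed : well_formed early_pattern.
Proof. by vm_cast_no_check (erefl true). Qed.

Lemma late_pattern_well_formed : well_formed late_pattern.
Proof. by vm_cast_no_check (erefl true). Qed.

Lemma nonorientable_patterns_ok : all nonorientable_pattern nonorientable_patterns.
Proof. by vm_cast_no_check (erefl true). Qed.

Lemma orientable_patterns_ok : all orientable_pattern orientable_patterns.
Proof. by vm_cast_no_check (erefl true). Qed.

Lemma nonorientable_patterns_distinct :
  pairwise (fun p q => ~~ occurs [:: p] (links_of q)) nonorientable_patterns.
Proof. by vm_cast_no_check (erefl true). Qed.

Lemma explored_first_triangle :
  explored (occurs [:: early_pattern; late_pattern]) pred0 [::].
Proof. by vm_cast_no_check (erefl true). Qed.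

Lemma explored_early_pattern :
  explored pred0
    (occurs_beyond early_pattern (nonorientable_patterns ++ orientable_patterns))
    early_pattern.
Proof. by vm_cast_no_check (erefl true). Qed.

Lemma explored_late_pattern :
  explored (occurs [:: early_pattern])
    (occurs (nonorientable_patterns ++ orientable_patterns)) late_pattern.
Proof. by vm_cast_no_check (erefl true). Qed.

Lemma triangular_maps : exactly_up_to_iso 28 triangular_map.
Proof.
exact: (triangular_maps_classified early_pattern_well_formed
  late_pattern_well_formed nonorientable_patterns_ok orientable_patterns_ok
  explored_first_triangle explored_early_pattern explored_late_pattern
  nonorientable_patterns_distinct).
Qed.

Lemma heptagonal_maps : exactly_up_to_iso 28 heptagonal_map.
Proof. exact: exactly_dual dual_triangular dual_heptagonal triangular_maps. Qed.

Theorem corollary8 :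
  [/\ exactly_up_to_iso 56 (fun M : cell_complex =>
        [/\ on_nonorientable_surface 4 M, equivelar M & polyhedral M]),
      exactly_up_to_iso 28 (fun M : cell_complex =>
        [/\ on_nonorientable_surface 4 M, equivelar_type_n 3 7 12 M
          & polyhedral M])
    & exactly_up_to_iso 28 (fun M : cell_complex =>
        [/\ on_nonorientable_surface 4 M, equivelar_type_n 7 3 28 M
          & polyhedral M])].
Proof.
split; [|exact: triangular_maps|exact: heptagonal_maps].
apply: (exactly_ext equivelar_polyhedral_cases).
exact: (exactly_union triangular_heptagonal_disjoint triangular_maps heptagonal_maps).
Qed.
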